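(* Let $\alpha\in X\setminus\mathbb{Q}(i)$. The sequence $(\alpha^T_{(n)})$ produced from $\alpha$ by Tanaka's algorithm is purely periodic if and only if $\alpha$ is a quadratic irrational over $\mathbb{Q}(i)$ and $(\alpha,\alpha')\in N_2$, where $\alpha'$ is the conjugate of $\alpha$ over $\mathbb{Q}(i)$.
   Context: Let $X=\{u(1+i)+v(1-i): -1/2\le u,v<1/2\}$. For $z=u(1+i)+v(1-i)$ ($u,v\in\mathbb{R}$) let $\lfloor z\rfloor_T=\lfloor u+\tfrac12\rfloor(1+i)+\lfloor v+\tfrac12\rfloor(1-i)$, and define $T_T:X\to X$ by $T_T(z)=1/z-\lfloor1/z\rfloor_T$ for $z\ne0$, $T_T(0)=0$. Tanaka's algorithm: $\alpha^T_{(1)}=\alpha$; if $\alpha^T_{(n)}\ne0$ then $\alpha^T_{(n+1)}=T_T(\alpha^T_{(n)})$; if $\alpha^T_{(n)}=0$ the sequence terminates. Purely periodic means the sequence is infinite and there is $l\ge1$ with $\alpha^T_{(n+l)}=\alpha^T_{(n)}$ for all $n\ge1$. For $1\le j\le4$: $X_j=\{z\in X: |z-i^{k+j-1}(1+i)/2|>\sqrt2/2\text{ for }k=0,1,2\}$, $X_{j+4}=\{z\in X: |z-i^{k+j-1}(1-i)/2|<\sqrt2/2\text{ for }k=0,1\}$, $W_j=\{z: |z|>1,\ |z-i^{j-1}(1-i)|\ge1\}$, $W_{j+4}=\{z: |z|>1,\ |z-i^{k+j-1}(1-i)|\ge1\text{ for }k=0,1\}$, $K_j=\{z: |z-i^{j-1}(\tfrac12-\tfrac12i)|=\tfrac{\sqrt2}2,\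 |z|\le1\}$, $K_j'=\{z: |z-i^{j-1}(\tfrac12-\tfrac12i)|=\tfrac{\sqrt2}2,\ |z|>1\}$, $Y_j=\{i^{j-1}(s-it): s,t\in\mathbb{R},\ s+t=1,\ 0\le s\le1\}$, $Y_j'=\{i^{j-1}(s-it): s,t\in\mathbb{R},\ s+t=1,\ s\le0,\ t\ge1\}$. $N_2=\bigcup_{j=1}^8(X_j\times W_j)\cup\bigcup_{j=3}^4(Y_j\times Y_j')\cup\bigcup_{j=1}^2(K_j\times K_j')$. *)

(* Defs.v *)
From mathcomp Require Import all_boot all_order all_algebra.
From mathcomp Require Import complex.
From mathcomp Require Import boolp classical_sets reals.
From mathcomp Require Import ring.

Set Implicit Arguments.
Unset Strict Implicit.
Unset Printing Implicit Defensive.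

Import Order.TTheory GRing.Theory Num.Theory.
Local Open Scope classical_set_scope.
Local Open Scope ring_scope.
Local Open Scope complex_scope.

(* The complex numbers are R[i] for R : realType.  The norm `|z| on R[i] takes
   values in R[i]; it is always real, and the order of R[i] restricted to real
   elements is the usual one. *)

(* The unique u, v in R with z = u(1+i) + v(1-i); see ucoord_vcoordE. *)
Definition ucoord (R : realType) (z : R[i]) : R := (complex.Re z + complex.Im z) / 2.
Definition vcoord (R : realType) (z : R[i]) : R := (complex.Re z - complex.Im z) / 2.

Lemma ucoord_vcoordE (R : realType) (z : R[i]) (u v : R) :
  z = u%:C * (1 + 'i%C) + v%:C * (1 - 'i%C) <-> u = ucoord z /\ v = vcoord z.
Proof.
case: z => x y; rewrite /ucoord /vcoord /=; split.
  move=> /eqP; rewrite eq_complex /= => /andP[/eqP-> /eqP->].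
  by split; field.
move=> [-> ->]; apply/eqP; rewrite eq_complex /=.
by apply/andP; split; apply/eqP; field.
Qed.

Definition tanakaX (R : realType) : set R[i] :=
  [set z | exists u v : R,
     [/\ z = u%:C * (1 + 'i%C) + v%:C * (1 - 'i%C),
         - (1 / 2) <= u < 1 / 2 & - (1 / 2) <= v < 1 / 2]].

Definition tanaka_floor (R : realType) (z : R[i]) : R[i] :=
  (Num.floor (ucoord z + 1 / 2))%:~R * (1 + 'i%C)
  + (Num.floor (vcoord z + 1 / 2))%:~R * (1 - 'i%C).

Definition tanaka_map (R : realType) (z : R[i]) : R[i] :=
  if z == 0 then 0 else 1 / z - tanaka_floor (1 / z).

(* None means that the sequence has terminated. *)
Definition tanaka_step (R : realType) (o : option R[i]) : option R[i] :=
  if o is Some z then (if z == 0 then None else Some (tanaka_map z)) else None.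

(* The n-th term of the sequence, indexed from n = 1; the value at n = 0 is
   meaningless. *)
Definition tanaka_seq (R : realType) (alpha : R[i]) (n : nat) : option R[i] :=
  iter n.-1 (@tanaka_step R) (Some alpha).

Definition purely_periodic (R : realType) (alpha : R[i]) : Prop :=
  (forall n : nat, (1 <= n)%N -> tanaka_seq alpha n <> None) /\
  exists l : nat, (1 <= l)%N /\
    forall n : nat, (1 <= n)%N -> tanaka_seq alpha (n + l) = tanaka_seq alpha n.

Definition Qi (R : realType) : set R[i] :=
  [set z | exists p q : rat, z = ratr p + 'i%C * ratr q].

Definition Qi_minpoly (R : realType) (alpha : R[i]) (p : {poly R[i]}) : Prop :=
  [/\ p \is monic, (forall k : nat, Qi p`_k), root p alpha &
      forall q : {poly R[i]}, q != 0 -> (forall k : nat, Qi q`_k) ->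
        root q alpha -> (size p <= size q)%N].

Definition quadratic_irrational (R : realType) (alpha : R[i]) : Prop :=
  exists p : {poly R[i]}, Qi_minpoly alpha p /\ size p = 3%N.

(* beta is the other root of the (quadratic) minimal polynomial of alpha. *)
Definition Qi_conjugate (R : realType) (alpha beta : R[i]) : Prop :=
  Qi_minpoly alpha (('X - alpha%:P) * ('X - beta%:P)).

Definition sqrt2_half (R : realType) : R[i] := (Num.sqrt 2 / 2)%:C.

(* In the next definitions the index j ranges over 1, ..., 4; the families X_j
   and W_j for 1 <= j <= 8 are assembled in setX8 and setW8. *)
Definition setX_low (R : realType) (j : nat) : set R[i] :=
  [set z | tanakaX z /\ forall k : nat, (k <= 2)%N ->
     `|z - 'i%C ^+ (k + j - 1) * (1 + 'i%C) / 2| > sqrt2_half R].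

Definition setX_high (R : realType) (j : nat) : set R[i] :=
  [set z | tanakaX z /\ forall k : nat, (k <= 1)%N ->
     `|z - 'i%C ^+ (k + j - 1) * (1 - 'i%C) / 2| < sqrt2_half R].

Definition setW_low (R : realType) (j : nat) : set R[i] :=
  [set z | `|z| > 1 /\ `|z - 'i%C ^+ (j - 1) * (1 - 'i%C)| >= 1].

Definition setW_high (R : realType) (j : nat) : set R[i] :=
  [set z | `|z| > 1 /\ forall k : nat, (k <= 1)%N ->
     `|z - 'i%C ^+ (k + j - 1) * (1 - 'i%C)| >= 1].

Definition setX8 (R : realType) (j : nat) : set R[i] :=
  if (j <= 4)%N then setX_low j else setX_high (j - 4).

Definition setW8 (R : realType) (j : nat) : set R[i] :=
  if (j <= 4)%N then setW_low j else setW_high (j - 4).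

Definition setK (R : realType) (j : nat) : set R[i] :=
  [set z | `|z - 'i%C ^+ (j - 1) * (1 / 2 - 1 / 2 * 'i%C)| = sqrt2_half R
           /\ `|z| <= 1].

Definition setK' (R : realType) (j : nat) : set R[i] :=
  [set z | `|z - 'i%C ^+ (j - 1) * (1 / 2 - 1 / 2 * 'i%C)| = sqrt2_half R
           /\ `|z| > 1].

Definition setY (R : realType) (j : nat) : set R[i] :=
  [set z | exists s t : R,
     [/\ z = 'i%C ^+ (j - 1) * (s%:C - 'i%C * t%:C), s + t = 1 & 0 <= s <= 1]].

Definition setY' (R : realType) (j : nat) : set R[i] :=
  [set z | exists s t : R,
     [/\ z = 'i%C ^+ (j - 1) * (s%:C - 'i%C * t%:C), s + t = 1, s <= 0 & 1 <= t]].

Definition setN2 (R : realType) : set (R[i] * R[i]) :=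
  (\bigcup_(j in [set j : nat | (1 <= j <= 8)%N]) (setX8 j `*` setW8 j))
  `|` (\bigcup_(j in [set j : nat | (3 <= j <= 4)%N]) (setY j `*` setY' j))
  `|` (\bigcup_(j in [set j : nat | (1 <= j <= 2)%N]) (setK j `*` setK' j)).

(* Main.v *)
(* Write [w = 1 / alpha] and let [a] be its digit.  Conjugation over [Q(i)]
   commutes with [x |-> 1 / x - a], so the algorithm acts on conjugate pairs by
   [(alpha, beta) |-> (1 / alpha - a, 1 / beta - a)].  Up to boundary cases [N2]
   says: [|beta| > 1], and [1 / beta] is at distance at least 1 from each of
   the lattice points [e = +-(1 + i), +-(1 - i)] lying on the same side as [w]
   (coordinate of [w] along [e] larger than [1/2]).  This condition is preserved
   by the action, and on it the digit can be recovered from the image, so the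
   action is injective.  The boundary cases disappear because a circle with
   coefficients in [Q(i)] passes through [alpha] iff it passes through [beta].

   If [(alpha, beta)] is in [N2], the pairs of the orbit come from quadratic
   forms over [Z[i]] of constant discriminant.  The orbit of [alpha] returns
   infinitely often to [|alpha|^2 <= 15/16], because near a vertex [e] of [X]
   the quantity [1 / |alpha - e|^2] decreases by [1/2] at each step; at those
   times the coefficients of the form are bounded, so a pair is repeated, and
   injectivity makes the orbit purely periodic.

   Conversely, along a periodic orbit the ratios [- q_{n-1} / q_n] of the
   denominators of the convergents satisfy the closed form of the condition and
   converge to [1 / beta] along multiples of the period. *)

Require Import Defs.
From mathcomp Require Import all_boot all_order all_algebra.
From mathcomp Require Import complex.
From mathcomp Require Import boolp classical_sets reals.
From mathcomp Require Import ring lra zify.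

Set Implicit Arguments.
Unset Strict Implicit.
Unset Printing Implicit Defensive.

Import Order.TTheory GRing.Theory Num.Theory.
Local Open Scope classical_set_scope.
Local Open Scope ring_scope.
Local Open Scope complex_scope.

(** * Squared norm and coordinates along 1 + i and 1 - i *)

Definition sqnorm (R : realType) (z : R[i]) : R :=
  complex.Re z ^+ 2 + complex.Im z ^+ 2.

Section Coordinates.
Variable R : realType.
Implicit Types z w : R[i].

Lemma sqnormE z : sqnorm z = 2 * (ucoord z ^+ 2 + vcoord z ^+ 2).
Proof. case: z => x y; rewrite /sqnorm /ucoord /vcoord /=; by field. Qed.

Lemma uv_inj z w : ucoord z = ucoord w -> vcoord z = vcoord w -> z = w.
Proof.
case: z => x y; case: w => x' y'; rewrite /ucoord /vcoord /= => hu hv.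
by apply/eqP; rewrite eq_complex /=; apply/andP; split; apply/eqP; lra.
Qed.

Lemma ucoordD z w : ucoord (z + w) = ucoord z + ucoord w.
Proof. case: z w => x y [x' y']; rewrite /ucoord /=; by field. Qed.
Lemma vcoordD z w : vcoord (z + w) = vcoord z + vcoord w.
Proof. case: z w => x y [x' y']; rewrite /vcoord /=; by field. Qed.
Lemma ucoordN z : ucoord (- z) = - ucoord z.
Proof. case: z => x y; rewrite /ucoord /=; by field. Qed.
Lemma vcoordN z : vcoord (- z) = - vcoord z.
Proof. case: z => x y; rewrite /vcoord /=; by field. Qed.
Lemma ucoordB z w : ucoord (z - w) = ucoord z - ucoord w.
Proof. by rewrite ucoordD ucoordN. Qed.
Lemma vcoordB z w : vcoord (z - w) = vcoord z - vcoord w.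
Proof. by rewrite vcoordD vcoordN. Qed.

Lemma sqnormM z w : sqnorm (z * w) = sqnorm z * sqnorm w.
Proof. case: z w => x y [x' y']; rewrite /sqnorm /=; ring. Qed.
Lemma sqnormN z : sqnorm (- z) = sqnorm z.
Proof. case: z => x y; rewrite /sqnorm /=; ring. Qed.
Lemma sqnorm1 : sqnorm (1 : R[i]) = 1.
Proof. rewrite /sqnorm /=; ring. Qed.
Lemma sqnorm_ge0 z : 0 <= sqnorm z.
Proof. by rewrite addr_ge0 ?sqr_ge0. Qed.
Lemma sqnorm_eq0 z : (sqnorm z == 0) = (z == 0).
Proof.
by rewrite paddr_eq0 ?sqr_ge0// !sqrf_eq0 eq_complex.
Qed.
Lemma sqnorm_gt0 z : z != 0 -> 0 < sqnorm z.
Proof. by move=> z0; rewrite lt0r sqnorm_eq0 z0 sqnorm_ge0. Qed.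
Lemma sqnormV z : z != 0 -> sqnorm z^-1 = (sqnorm z)^-1.
Proof.
move=> z0; apply: (mulfI (x := sqnorm z)); first by rewrite sqnorm_eq0.
by rewrite -sqnormM !divff ?sqnorm1 ?sqnorm_eq0.
Qed.
(** The coordinates are swapped because complex conjugation exchanges 1 + i and 1 - i. *)
Lemma ucoordV z : ucoord z^-1 = vcoord z / sqnorm z.
Proof. by case: z => x y; rewrite /ucoord /vcoord /sqnorm /=; ring. Qed.
Lemma vcoordV z : vcoord z^-1 = ucoord z / sqnorm z.
Proof. by case: z => x y; rewrite /ucoord /vcoord /sqnorm /=; ring. Qed.

Lemma norm_sqnorm z : `|z| = (Num.sqrt (sqnorm z))%:C.
Proof. by rewrite normc_def. Qed.

Lemma norm_lt_sqnorm z (r : R) : 0 <= r -> (`|z| < r%:C) = (sqnorm z < r ^+ 2).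
Proof.
move=> r0; rewrite norm_sqnorm ltcR -[X in _ < X](ger0_norm r0) -sqrtr_sqr.
by rewrite !ltNge ler_sqrt// sqnorm_ge0.
Qed.

Lemma norm_gt_sqnorm z (r : R) : 0 <= r -> (r%:C < `|z|) = (r ^+ 2 < sqnorm z).
Proof.
move=> r0; rewrite norm_sqnorm ltcR -[X in X < _](ger0_norm r0) -sqrtr_sqr.
by rewrite !ltNge ler_sqrt// sqr_ge0.
Qed.
End Coordinates.

(** * The admissible region in coordinates *)

Section WeakReal.
Variable R : realFieldType.
Implicit Types P Q x y : R.

(* [(P, Q)] are the coordinates of [1 / alpha] and [(x, y)] those of
   [1 / beta]; this is the closed form of the condition on conjugate pairs. *)
Definition weakR P Q x y := [/\ x ^+ 2 + y ^+ 2 <= 1 / 2,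
  1 / 2 < P -> 1 / 2 <= (x - 1) ^+ 2 + y ^+ 2,
  P < - (1 / 2) -> 1 / 2 <= (x + 1) ^+ 2 + y ^+ 2,
  1 / 2 < Q -> 1 / 2 <= x ^+ 2 + (y - 1) ^+ 2 &
  Q < - (1 / 2) -> 1 / 2 <= x ^+ 2 + (y + 1) ^+ 2].

(** Far points yield to the triangle inequality; what remains is the origin and the four neighbours
    that occur in [weakR]. *)
Lemma lattice_cases (k l : int) : 2 <= k ^+ 2 + l ^+ 2 \/
  [\/ k = 0 /\ l = 0, k = 1 /\ l = 0, k = -1 /\ l = 0 | k = 0 /\ (l = 1 \/ l = -1)].
Proof.
have [hk|hk] := leP 2 (k ^+ 2); first by left; have := sqr_ge0 l; lia.
have [hl|hl] := leP 2 (l ^+ 2); first by left; have := sqr_ge0 k; lia.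
have k1 : k = -1 \/ k = 0 \/ k = 1 by nia.
have l1 : l = -1 \/ l = 0 \/ l = 1 by nia.
case: k1 => [->|[->|->]]; case: l1 => [->|[->|->]]; try (by left);
 right; try (by constructor 1); try (by constructor 2);
 try (by constructor 3); constructor 4; by [split; [|left]|split; [|right]].
Qed.

Lemma intr_sqr_sum (k l : int) : 2 <= k ^+ 2 + l ^+ 2 ->
  2 <= k%:~R ^+ 2 + l%:~R ^+ 2 :> R.
Proof. by move=> h; rewrite -!rmorphXn -rmorphD /= (ler_int R 2). Qed.

(* Triangle inequality: [|(k, l)| >= sqrt 2] and [|(x, y)| <= sqrt (1/2)]. *)
Lemma far_lattice (k l : int) x y : 2 <= k ^+ 2 + l ^+ 2 ->
  x ^+ 2 + y ^+ 2 <= 1 / 2 -> 1 / 2 <= (x - k%:~R) ^+ 2 + (y - l%:~R) ^+ 2.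
Proof.
move=> /intr_sqr_sum; set p : R := k%:~R; set q : R := l%:~R => hK hn.
set m := p * x + q * y; set K := p ^+ 2 + q ^+ 2 in hK *.
set n := x ^+ 2 + y ^+ 2 in hn.
have hm : m ^+ 2 <= K * n by have := sqr_ge0 (p * y - q * x); rewrite /m /K /n; nra.
have n0 : 0 <= n by rewrite addr_ge0 ?sqr_ge0.
suff : 2 * m <= K + n - 1 / 2 by rewrite /m /K /n; lra.
rewrite leNgt; apply/negP => h.
have : (K + n - 1 / 2) ^+ 2 < 4 * m ^+ 2 by nra.
suff : 4 * (K * n) <= (K + n - 1/2) ^+ 2 by lra.
have h3 : 3/2 <= K - n by lra.
nra.
Qed.

Lemma far_lattice_strict (k l : int) x y : 2 <= k ^+ 2 + l ^+ 2 ->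
  x ^+ 2 + y ^+ 2 < 1 / 2 -> 1 / 2 < (x - k%:~R) ^+ 2 + (y - l%:~R) ^+ 2.
Proof.
move=> hK hn; rewrite lt_neqAle far_lattice ?(ltW hn)// andbT.
apply/eqP => e.
move: hK => /intr_sqr_sum; move: e.
set p : R := k%:~R; set q : R := l%:~R => e hK.
(* By the parallelogram law, [(2x - p)^2 + (2y - q)^2] would be negative. *)
have := sqr_ge0 (x - p + x); have := sqr_ge0 (y - q + y); nra.
Qed.

Lemma weakR_avoid P Q x y (k l : int) : weakR P Q x y ->
  (k = 0 -> l = 0 -> False) ->
  (k = 1 -> l = 0 -> 1 / 2 < P) -> (k = -1 -> l = 0 -> P < - (1 / 2)) ->
  (k = 0 -> l = 1 -> 1 / 2 < Q) -> (k = 0 -> l = -1 -> Q < - (1 / 2)) ->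
  1 / 2 <= (x - k%:~R) ^+ 2 + (y - l%:~R) ^+ 2.
Proof.
case=> hn h1 h2 h3 h4 h0 k1 k2 l1 l2.
have [hbig|] := lattice_cases k l; first exact: far_lattice.
case=> [[ek el]|[ek el]|[ek el]|[ek [el|el]]].
- by case: h0.
- by rewrite ek el subr0; apply/h1/k1.
- by rewrite ek el subr0 opprK; apply/h2/k2.
- by rewrite ek el subr0; apply/h3/l1.
- by rewrite ek el subr0 opprK; apply/h4/l2.
Qed.

Lemma int_pred (l m n : int) : l + m = n -> l%:~R = n%:~R - m%:~R :> R.
Proof. by move=> <-; rewrite intrD addrK. Qed.

Section Step.
(** [(k, l)] is the digit and [(p, q)] the image of [alpha]. [PQ_far] says that |alpha| < 1, and the
    last two bounds that [alpha] lies in [X]. *)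
Variables (P Q : R) (k l : int).
Let p := P - k%:~R.
Let q := Q - l%:~R.
Let n := P ^+ 2 + Q ^+ 2.
Hypothesis p_bound : - (1 / 2) <= p < 1 / 2.
Hypothesis q_bound : - (1 / 2) <= q < 1 / 2.
Hypothesis PQ_far : 1 / 2 < n.
Hypothesis P_bound : - n <= P < n.
Hypothesis Q_bound : - n <= Q < n.

Ltac intro_digits :=
  let ek := fresh in let el := fresh in
  move=> /int_pred ek /int_pred el;
  move: p_bound q_bound PQ_far P_bound Q_bound; rewrite /p /q /n ek el;
  move=> /andP[? ?] /andP[? ?] ? /andP[? ?] /andP[? ?].

(** A zero digit would leave [(P, Q)] in the square where [n] is at most 1/2; the digit [(1, 0)]
    with [P = 1/2] fails for the same reason. *)
Lemma weakR_step0 x y : weakR P Q x y ->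
  1 / 2 <= (x - k%:~R) ^+ 2 + (y - l%:~R) ^+ 2.
Proof.
move=> h; rewrite -[k]addr0 -[l]addr0.
apply: (weakR_avoid h); intro_digits; nra.
Qed.

(** The premise on [q] says that the inverse of the image has first coordinate above 1/2, so its
    clause must avoid [(k, l + 1)]. If that point were the origin, then [n < - Q], against
    [Q_bound]. *)
Lemma weakR_step1 x y : weakR P Q x y -> p ^+ 2 + q ^+ 2 < q ->
  1 / 2 <= (x - k%:~R) ^+ 2 + (y - (l + 1)%:~R) ^+ 2.
Proof.
move=> h; rewrite -[k in k%:~R]addr0 => hq.
apply: (weakR_avoid h); intro_digits; move: hq; rewrite /p /q => hq; nra.
Qed.

Lemma weakR_step2 x y : weakR P Q x y -> p ^+ 2 + q ^+ 2 < - q ->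
  1 / 2 <= (x - k%:~R) ^+ 2 + (y - (l - 1)%:~R) ^+ 2.
Proof.
move=> h; rewrite -[k in k%:~R]addr0 => hq.
apply: (weakR_avoid h); intro_digits; move: hq; rewrite /p /q => hq; nra.
Qed.
(* The circle [p^2 + q^2 = - q] meets [x^2 + y^2 > 1/2] only within distance
   [sqrt (1/2)] of [(0, -1)]. *)
Lemma weakR_noncircle x y : weakR P Q x y -> x ^+ 2 + y ^+ 2 < 1 / 2 ->
  p ^+ 2 + q ^+ 2 < 1 / 2 -> p ^+ 2 + q ^+ 2 = - q ->
  1 / 2 < (x - k%:~R) ^+ 2 + (y - l%:~R) ^+ 2 ->
  (x - k%:~R) ^+ 2 + (y - l%:~R) ^+ 2 = - (y - l%:~R) -> False.
Proof.
move=> h xy pq hq b1 bq.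
suff : 1 / 2 <= (x - k%:~R) ^+ 2 + (y - (l - 1)%:~R) ^+ 2.
  rewrite intrB; nra.
rewrite -[k in k%:~R]addr0.
(* When [(k, l - 1)] is the origin the circle gives [n = Q], which the strict bound [Q < n]
   forbids. *)
apply: (weakR_avoid h); intro_digits; move: hq pq; rewrite /p /q => hq pq; nra.
Qed.
End Step.

Lemma weakR_swap P Q x y : weakR P Q x y -> weakR Q P y x.
Proof.
case=> h h1 h2 h3 h4; split; first by rewrite addrC.
- by rewrite addrC.
- by rewrite addrC.
- by rewrite addrC.
- by rewrite addrC.
Qed.

(** For the shift [(1, 0)], either [P < -1/2] and the clause at [(-1, 0)] pushes the shifted point
    out of the disc, or [P + 1 > 1/2] and the clause at [(1, 0)] pushes the original one out.
    Excluding the value -1/2 makes this exhaustive. *)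
Lemma weakR_digit_inj P Q x y (k l : int) :
  weakR P Q x y -> x ^+ 2 + y ^+ 2 < 1 / 2 ->
  weakR (P + k%:~R) (Q + l%:~R) (x + k%:~R) (y + l%:~R) ->
  (x + k%:~R) ^+ 2 + (y + l%:~R) ^+ 2 < 1 / 2 ->
  P <> - (1 / 2) -> Q <> - (1 / 2) ->
  P + k%:~R <> - (1 / 2) -> Q + l%:~R <> - (1 / 2) -> k = 0 /\ l = 0.
Proof.
move=> [_ h1 h2 h3 h4] hn [_ h1' h2' h3' h4'] hn' eP eQ eP' eQ'.
have [hbig|] := lattice_cases k l.
  move: hbig; rewrite -sqrrN -(sqrrN l) => /far_lattice_strict/(_ hn).
  rewrite !rmorphN !opprK /= => h.
  by have := lt_trans h hn'; rewrite ltxx.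
have neq (A : R) : A <> - (1 / 2) -> A < - (1 / 2) \/ - (1 / 2) < A.
  by move=> /eqP; rewrite neq_lt => /orP.
have NP := neq _ eP; have NQ := neq _ eQ.
have NP' := neq _ eP'; have NQ' := neq _ eQ'.
case=> [//|[ek el]|[ek el]|[ek [el|el]]]; exfalso.
- clear - hn hn' h2 h1' NP NP' ek el; move: hn' h1' NP'.
  by rewrite ek el addr0 => ? ? [?|?]; case: NP => ?; lra.
- clear - hn hn' h1 h2' NP NP' ek el; move: hn' h2' NP'.
  by rewrite ek el rmorphN addr0 => ? ? [?|?]; case: NP => ?; lra.
- clear - hn hn' h4 h3' NQ NQ' ek el; move: hn' h3' NQ'.
  by rewrite ek el addr0 => ? ? [?|?]; case: NQ => ?; lra.
- clear - hn hn' h3 h4' NQ NQ' ek el; move: hn' h4' NQ'.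
  by rewrite ek el rmorphN addr0 => ? ? [?|?]; case: NQ => ?; lra.
Qed.
End WeakReal.

(** * Inversion in coordinates *)

Section WeakInv.
Variable R : realFieldType.
Implicit Types x y n : R.

Lemma gt_half_div x n : 0 < n -> (1 / 2 < x / (2 * n)) = (n < x).
Proof. by move=> n0; rewrite ltr_pdivlMr; [congr (_ < _); field|lra]. Qed.

Lemma lt_half_div x n : 0 < n -> (x / (2 * n) < - (1 / 2)) = (n < - x).
Proof.
by move=> n0; rewrite ltrNr -mulNr gt_half_div.
Qed.

Lemma half_div_bounds x n : 0 < n ->
  (- (1 / 2) <= x / (2 * n) < 1 / 2) = (- n <= x < n).
Proof.
move=> n0; rewrite ltr_pdivrMr ?ler_pdivlMr; [|lra..].
have -> : - (1 / 2) * (2 * n) = - n by field.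
by have -> : 1 / 2 * (2 * n) = n by field.
Qed.

(** A circle of radius 1 about a point of norm sqrt 2 is orthogonal to the unit circle, so inversion
    only swaps the coordinates of its center. *)
Lemma inv_dist (e x y : R) : e ^+ 2 = 1 -> let n := x ^+ 2 + y ^+ 2 in 0 < n ->
  1 / 2 <= x ^+ 2 + (y - e) ^+ 2 ->
  1 / 2 <= (y / (2 * n) - e) ^+ 2 + (x / (2 * n)) ^+ 2.
Proof.
move=> e1 n n0 h.
have -> : (y / (2 * n) - e) ^+ 2 + (x / (2 * n)) ^+ 2 =
  1 / 2 + (x ^+ 2 + (y - e) ^+ 2 - 1 / 2) / (2 * n) + (e ^+ 2 - 1) * (1 - (2 * n)^-1).
  by rewrite /n; field; rewrite -/n gt_eqF.
rewrite e1 subrr mul0r addr0 lerDl divr_ge0//; lra.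
Qed.

Lemma weakR_inv p q x y : 0 < p ^+ 2 + q ^+ 2 -> 1 / 2 <= x ^+ 2 + y ^+ 2 ->
  (p ^+ 2 + q ^+ 2 < q -> 1 / 2 <= x ^+ 2 + (y - 1) ^+ 2) ->
  (p ^+ 2 + q ^+ 2 < - q -> 1 / 2 <= x ^+ 2 + (y + 1) ^+ 2) ->
  (p ^+ 2 + q ^+ 2 < p -> 1 / 2 <= (x - 1) ^+ 2 + y ^+ 2) ->
  (p ^+ 2 + q ^+ 2 < - p -> 1 / 2 <= (x + 1) ^+ 2 + y ^+ 2) ->
  weakR (q / (2 * (p ^+ 2 + q ^+ 2))) (p / (2 * (p ^+ 2 + q ^+ 2)))
        (y / (2 * (x ^+ 2 + y ^+ 2))) (x / (2 * (x ^+ 2 + y ^+ 2))).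
Proof.
move=> pq xy h1 h2 h3 h4.
have n0 : 0 < x ^+ 2 + y ^+ 2 by lra.
have n0' : 0 < y ^+ 2 + x ^+ 2 by lra.
have e1 : (1 : R) ^+ 2 = 1 by rewrite expr1n.
have e2 : (-1 : R) ^+ 2 = 1 by rewrite sqrrN expr1n.
split; rewrite ?gt_half_div ?lt_half_div//.
- rewrite !expr_div_n -mulrDl [y ^+ 2 + _]addrC exprMn.
  set n := x ^+ 2 + _ in xy n0 *.
  rewrite (_ : n / _ = (4 * n)^-1); last by field; rewrite gt_eqF.
  by rewrite div1r lef_pV2 ?posrE; lra.
- by move=> /h1; apply: inv_dist.
- by move=> /h2; have := inv_dist e2 n0; rewrite !opprK.
- move=> /h3; have := inv_dist e1 n0'.
  by rewrite [y ^+ 2 + x ^+ 2]addrC [y ^+ 2 + _]addrC [_ + (y / _) ^+ 2]addrC.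
- move=> /h4; have := inv_dist e2 n0'; rewrite !opprK.
  by rewrite [y ^+ 2 + x ^+ 2]addrC [y ^+ 2 + _]addrC [_ + (y / _) ^+ 2]addrC.
Qed.
End WeakInv.

(** * Conjugates over Q(i) *)

Section GaussianRationals.
Variable R : realType.
Implicit Types z w : R[i].

Lemma ratr_complex (p : rat) : ratr p = (ratr p : R)%:C.
Proof. by rewrite fmorph_rat. Qed.

Lemma QiP z : Qi z <-> exists p q : rat, complex.Re z = ratr p /\ complex.Im z = ratr q.
Proof.
split=> [[p [q ->]]|[p [q [hp hq]]]]; exists p, q.
  by rewrite !ratr_complex /=; split; ring.
case: z hp hq => x y /= -> ->; rewrite !ratr_complex.
by apply/eqP; rewrite eq_complex /=; apply/andP; split; apply/eqP; ring.
Qed.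

Lemma QiD z w : Qi z -> Qi w -> Qi (z + w).
Proof.
move=> /QiP[p [q [hp hq]]] /QiP[p' [q' [hp' hq']]]; apply/QiP.
exists (p + p'), (q + q').
by case: z w hp hq hp' hq' => ? ? [? ?] /= -> -> -> ->; rewrite !rmorphD.
Qed.
Lemma QiM z w : Qi z -> Qi w -> Qi (z * w).
Proof.
move=> /QiP[p [q [hp hq]]] /QiP[p' [q' [hp' hq']]]; apply/QiP.
exists (p * p' - q * q'), (p * q' + q * p').
case: z w hp hq hp' hq' => ? ? [? ?] /= -> -> -> ->.
by rewrite rmorphB rmorphD !rmorphM.
Qed.
Lemma QiN z : Qi z -> Qi (- z).
Proof.
move=> /QiP[p [q [hp hq]]]; apply/QiP; exists (- p), (- q).
by case: z hp hq => ? ? /= -> ->; rewrite !rmorphN.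
Qed.
Lemma QiB z w : Qi z -> Qi w -> Qi (z - w).
Proof. by move=> hz hw; apply/QiD/QiN. Qed.
Lemma Qi_conjc z : Qi z -> Qi z^*.
Proof.
move=> /QiP[p [q [hp hq]]]; apply/QiP; exists p, (- q).
by case: z hp hq => ? ? /= -> ->; rewrite !rmorphN.
Qed.
Lemma QiV z : Qi z -> Qi z^-1.
Proof.
move=> /QiP[p [q [hp hq]]]; apply/QiP.
exists (p / (p ^+ 2 + q ^+ 2)), (- q / (p ^+ 2 + q ^+ 2)).
case: z hp hq => ? ? /= -> ->.
by rewrite !(fmorph_div, rmorphD, rmorphN, rmorphXn, fmorphV, rmorphM) /= mulNr.
Qed.
Lemma Qi_div z w : Qi z -> Qi w -> Qi (z / w).
Proof. by move=> hz hw; apply/QiM/QiV. Qed.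
Lemma Qi_int (m : int) : Qi (m%:~R : R[i]).
Proof.
apply/QiP; exists m%:~R, 0; rewrite ratr_int rmorph0.
by rewrite -(rmorph_int (real_complex R)).
Qed.
Lemma Qi_0 : Qi (0 : R[i]). Proof. exact: (Qi_int 0). Qed.
Lemma Qi_1 : Qi (1 : R[i]). Proof. exact: (Qi_int 1). Qed.
Lemma Qi_nat (n : nat) : Qi (n%:R : R[i]). Proof. exact: (Qi_int n). Qed.
Lemma Qi_i : Qi ('i%C : R[i]).
Proof. by apply/QiP; exists 0, 1; rewrite /= rmorph0 rmorph1. Qed.

Lemma not_Qi_neq0 z : ~ Qi z -> z != 0.
Proof. by move=> h; apply/eqP => e; apply: h; rewrite e; apply: Qi_0. Qed.

End GaussianRationals.

(** Conjugacy through trace and norm; for irrational [z] it agrees with [Qi_conjugate], by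
    [Qi_conjugateE]. *)
Definition Qi_conj (R : realType) (z w : R[i]) := Qi (z + w) /\ Qi (z * w).

Section Conjugates.
Variable R : realType.
Implicit Types z w : R[i].

Lemma Qi_conj_sym z w : Qi_conj z w -> Qi_conj w z.
Proof. by case=> hS hP; split; rewrite 1?addrC 1?mulrC. Qed.

Lemma Qi_conj_irr z w : Qi_conj z w -> ~ Qi z -> ~ Qi w.
Proof.
by move=> [hS _] hz hw; apply: hz; rewrite -(addrK w z); apply: QiB.
Qed.

Lemma Qi_conj_neq z w : Qi_conj z w -> ~ Qi z -> z != w.
Proof.
move=> [hS _] hz; apply/eqP => e; apply: hz.
rewrite (_ : z = (z + w) / 2%:R); first exact/(Qi_div hS)/Qi_nat.
by rewrite -e; field.
Qed.

Lemma Qi_linear_eq0 a b z : ~ Qi z -> Qi a -> Qi b -> a * z + b = 0 -> a = 0.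
Proof.
move=> hz ha hb /eqP; rewrite addr_eq0 => /eqP e.
apply/eqP/negPn/negP => a0; apply: hz.
rewrite (_ : z = - b / a); first exact/Qi_div/ha/QiN.
by rewrite -e mulrC mulKf.
Qed.

Lemma Qi_conj_uniq z w w' : ~ Qi z -> Qi_conj z w -> Qi_conj z w' -> w = w'.
Proof.
move=> hz [hS hP] [hS' hP']; apply/eqP; rewrite -subr_eq0; apply/eqP.
apply: (@Qi_linear_eq0 _ (z * w' - z * w) z hz).
- by rewrite (_ : _ - _ = z + w - (z + w')); [apply: QiB|ring].
- exact: QiB.
- ring.
Qed.

(** Reducing by [z^2 = (z + w) z - z w] leaves a linear relation over Q(i), whose coefficients
    vanish because [z] is irrational. *)
Lemma Qi_conj_root z w a b c : ~ Qi z -> Qi_conj z w -> Qi a -> Qi b -> Qi c ->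
  a * z ^+ 2 + b * z + c = 0 -> a * w ^+ 2 + b * w + c = 0.
Proof.
move=> hz [hS hP] ha hb hc e.
have e1 : (a * (z + w) + b) * z + (c - a * (z * w)) = 0 by rewrite -e; ring.
have h1 : Qi (a * (z + w) + b) by apply: QiD => //; apply: QiM.
have h2 : Qi (c - a * (z * w)) by apply: QiB => //; apply: QiM.
have e2 := Qi_linear_eq0 hz h1 h2 e1.
have e3 : c = a * (z * w) by apply: subr0_eq; move: e1; rewrite e2 mul0r add0r.
rewrite e3 -[RHS](mul0r w) -e2; ring.
Qed.

(* On the circle [|z|^2 + q^* z + q z^* + r = 0] the conjugate [z^*] is the
   homography [- (q^* z + r) / (z + q)] of [z], so being on the circle is a
   quadratic equation over [Q(i)] satisfied by [z], hence by [w]. *)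
Lemma Qi_conj_circle z w q r : ~ Qi z -> Qi_conj z w -> Qi q -> Qi r ->
  z * z^* + q^* * z + q * z^* + r = 0 -> w * w^* + q^* * w + q * w^* + r = 0.
Proof.
move=> hz hzw hq hr e.
have [hS hP] := hzw.
have hS' := Qi_conjc hS; have hP' := Qi_conjc hP; have hq' := Qi_conjc hq.
have h2 : Qi (2%:R : R[i]) := @Qi_nat R 2.
(* [A t^2 + B t + C] is the product of [q^* t + r + z^* (t + q)] and [q^* t + r + w^* (t + q)]; the
   first factor vanishes at [t = z]. *)
pose A := q^* * q^* + (z + w)^* * q^* + (z * w)^*.
pose B := 2%:R * (q^* * r) + (z + w)^* * (q^* * q + r) + 2%:R * ((z * w)^* * q).
pose C := r * r + (z + w)^* * (r * q) + (z * w)^* * (q * q).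
have hA : Qi A by apply: QiD => //; apply: QiD; apply: QiM.
have hB : Qi B.
  apply: QiD; [apply: QiD|]; apply: QiM => //; try by apply: QiM.
  by apply: QiD => //; apply: QiM.
have hC : Qi C.
  by apply: QiD; [apply: QiD|]; apply: QiM => //; apply: QiM.
have ez : A * z ^+ 2 + B * z + C = 0.
  have er : r = - (z * z^* + q^* * z + q * z^*) by rewrite -[LHS]subr0 -e; ring.
  by rewrite /A /B /C er !rmorphD !rmorphM /=; ring.
have := Qi_conj_root hz hzw hA hB hC ez.
rewrite /A /B /C !rmorphD !rmorphM /= => e1.
have : (q^* * w + r + z^* * (w + q)) * (q^* * w + r + w^* * (w + q)) = 0.
  by rewrite -e1; ring.
move=> /eqP; rewrite mulf_eq0 => /orP[]/eqP e2; last by rewrite -e2; ring.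
(* If the first factor also vanishes at [w], subtracting its value at [z] gives [z = - q], which is
   in Q(i). *)
have : (z^* + q^*) * (w - z) = 0.
  rewrite (_ : _ * _ = q^* * w + r + z^* * (w + q)
    - (z * z^* + q^* * z + q * z^* + r)); last by ring.
  by rewrite e2 e subr0.
move=> /eqP; rewrite mulf_eq0 subr_eq0 [w == z]eq_sym (negPf (Qi_conj_neq hzw hz)).
rewrite orbF -rmorphD /= conjc_eq0 addr_eq0 => /eqP zq.
by case: hz; rewrite zq; apply: QiN.
Qed.

Lemma Qi_conj_circleR z w (a b c : rat) : ~ Qi z -> Qi_conj z w ->
  sqnorm z + ratr a * ucoord z + ratr b * vcoord z + ratr c = 0 ->
  sqnorm w + ratr a * ucoord w + ratr b * vcoord w + ratr c = 0.
Proof.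
move=> hz hzw.
(* With this [q], the term [q^* t + q t^*] equals [a] times [ucoord t] plus [b] times [vcoord t]. *)
pose q : R[i] := ratr ((a + b) / 4) +i* ratr ((a - b) / 4).
pose r : R[i] := ratr c +i* ratr 0.
have e4 m n : ratr ((m + n) / 4) = (ratr m + ratr n) / 4 :> R.
  by rewrite fmorph_div rmorphD /=; congr (_ / _); exact: (ratr_nat R 4).
have key t : t * t^* + q^* * t + q * t^* + r =
    (sqnorm t + ratr a * ucoord t + ratr b * vcoord t + ratr c)%:C.
  case: t => x y; rewrite /q /r /sqnorm /ucoord /vcoord.
  rewrite !e4 rmorphN rmorph0 /=.
  by apply/eqP; rewrite eq_complex /=; apply/andP; split; apply/eqP; field.
have hq : Qi q by apply/QiP; exists ((a + b) / 4), ((a - b) / 4).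
have hr : Qi r by apply/QiP; exists c, 0.
move=> e; have := Qi_conj_circle hz hzw hq hr.
by rewrite !key e => /(_ erefl)/(congr1 (@complex.Re R)).
Qed.

Lemma Qi_conjV z w : ~ Qi z -> Qi_conj z w -> Qi_conj z^-1 w^-1.
Proof.
move=> hz hzw; have [hS hP] := hzw.
have z0 := not_Qi_neq0 hz; have w0 := not_Qi_neq0 (Qi_conj_irr hzw hz).
split; last by rewrite -invfM; apply: QiV.
by rewrite -[z^-1]mul1r -[w^-1]mul1r addf_div// !mul1r addrC; apply: Qi_div.
Qed.

Lemma Qi_conjB z w a : Qi a -> Qi_conj z w -> Qi_conj (z - a) (w - a).
Proof.
move=> ha [hS hP]; split.
  by rewrite addrACA -opprD; apply: QiB => //; apply: QiD.
rewrite (_ : _ * _ = z * w - a * (z + w) + a * a); last by ring.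
by apply: QiD; [apply: QiB => //|]; apply: QiM.
Qed.

End Conjugates.

(** * The algorithm on pairs *)

Section Dynamics.
Variable R : realType.
Implicit Types z w c : R[i].

Definition gauss_lattice (k l : int) : R[i] :=
  k%:~R * (1 + 'i%C) + l%:~R * (1 - 'i%C).

Lemma complex_int (k : int) : (k%:~R : R[i]) = (k%:~R : R)%:C.
Proof. by rewrite -(rmorph_int (real_complex R)). Qed.

Lemma ucoord_lattice k l : ucoord (gauss_lattice k l) = k%:~R.
Proof. by rewrite /gauss_lattice !complex_int /ucoord /=; field. Qed.
Lemma vcoord_lattice k l : vcoord (gauss_lattice k l) = l%:~R.
Proof. by rewrite /gauss_lattice !complex_int /vcoord /=; field. Qed.

Lemma Qi_lattice k l : Qi (gauss_lattice k l).
Proof.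
apply: QiD; apply: QiM; try exact: Qi_int; [apply: QiD|apply: QiB];
  by [apply: Qi_1|apply: Qi_i].
Qed.

Lemma tanakaXE z : tanakaX z <->
  - (1 / 2) <= ucoord z < 1 / 2 /\ - (1 / 2) <= vcoord z < 1 / 2.
Proof.
split=> [[u [v [/ucoord_vcoordE[-> ->]]]]//|[hu hv]].
by exists (ucoord z), (vcoord z); split => //; apply/ucoord_vcoordE.
Qed.

Definition digit z : R[i] := tanaka_floor z^-1.

Lemma Qi_digit z : Qi (digit z).
Proof. exact: Qi_lattice. Qed.

Lemma tanaka_mapE z : z != 0 -> tanaka_map z = z^-1 - digit z.
Proof. by rewrite /tanaka_map => /negPf ->; rewrite div1r. Qed.

Lemma digitP z : exists k l : int,
  [/\ digit z = gauss_lattice k l,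
      - (1 / 2) <= ucoord z^-1 - k%:~R < 1 / 2 &
      - (1 / 2) <= vcoord z^-1 - l%:~R < 1 / 2].
Proof.
exists (Num.floor (ucoord z^-1 + 1 / 2)), (Num.floor (vcoord z^-1 + 1 / 2)).
have h (x : R) : - (1 / 2) <= x - (Num.floor (x + 1 / 2))%:~R < 1 / 2.
  have := floor_le_tmp (x + 1 / 2); have := floorD1_gt (x + 1 / 2).
  by rewrite intrD; lra.
by split.
Qed.

Lemma tanaka_map_X z : z != 0 -> tanakaX (tanaka_map z).
Proof.
move=> z0; rewrite tanaka_mapE//; have [k [l [-> hk hl]]] := digitP z.
by apply/tanakaXE; rewrite ucoordD vcoordD ucoordN vcoordN ucoord_lattice vcoord_lattice.
Qed.

Lemma Qi_inv z : Qi z^-1 -> Qi z.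
Proof. by move=> /QiV; rewrite invrK. Qed.

Lemma tanaka_map_irr z : ~ Qi z -> ~ Qi (tanaka_map z).
Proof.
move=> hz; rewrite tanaka_mapE ?not_Qi_neq0// => h; apply/hz/Qi_inv.
by rewrite -(subrK (digit z) z^-1); apply/QiD/Qi_digit.
Qed.

(** Half-openness leaves -1 as the only vertex of the square in [X], and it is rational. *)
Lemma tanakaX_sqnorm_lt1 z : tanakaX z -> ~ Qi z -> sqnorm z < 1.
Proof.
move=> /tanakaXE[/andP[u1 u2] /andP[v1 v2]] hz; rewrite sqnormE.
rewrite ltNge; apply/negP => h.
have hu : ucoord z = - (1 / 2) by nra.
have hv : vcoord z = - (1 / 2) by nra.
apply: hz; rewrite (_ : z = -1); first exact/QiN/Qi_1.
by apply: uv_inj; rewrite ?hu ?hv /ucoord /vcoord /=; field.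
Qed.

(** [c] stands for [1 / beta] but is kept free: it will also be a ratio of denominators of
    convergents, which starts at 0. *)
Definition weak z c := weakR (ucoord z^-1) (vcoord z^-1) (ucoord c) (vcoord c).

Lemma inverse_bounds z : tanakaX z -> ~ Qi z ->
  let n := ucoord z^-1 ^+ 2 + vcoord z^-1 ^+ 2 in
  [/\ 1 / 2 < n, - n <= ucoord z^-1 < n & - n <= vcoord z^-1 < n].
Proof.
move=> zX zQ n; have z0 := not_Qi_neq0 zQ.
have zN : sqnorm z^-1 = 2 * n := sqnormE _.
have far : 1 / 2 < n.
  have : 1 < sqnorm z^-1.
    by rewrite sqnormV// invf_gt1 ?sqnorm_gt0// tanakaX_sqnorm_lt1.
  by rewrite zN; lra.
move: zX => /tanakaXE.
have -> : ucoord z = vcoord z^-1 / sqnorm z^-1 by rewrite -ucoordV invrK.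
have -> : vcoord z = ucoord z^-1 / sqnorm z^-1 by rewrite -vcoordV invrK.
by rewrite zN !half_div_bounds; [case|lra..].
Qed.

Lemma coordB_lattice z k l : ucoord (z - gauss_lattice k l) = ucoord z - k%:~R /\
  vcoord (z - gauss_lattice k l) = vcoord z - l%:~R.
Proof. by rewrite ucoordD vcoordD ucoordN vcoordN ucoord_lattice vcoord_lattice. Qed.

Lemma weak_step z c : tanakaX z -> ~ Qi z -> weak z c ->
  1 <= sqnorm (c - digit z) /\ weak (tanaka_map z) (c - digit z)^-1.
Proof.
move=> zX zQ hw.
have z0 := not_Qi_neq0 zQ; have z10 := not_Qi_neq0 (tanaka_map_irr zQ).
have [k [l [ek hk hl]]] := digitP z.
have [far hu hv] := inverse_bounds zX zQ.
(* Exchanging the coordinates turns the steps for [q] into those for [p]. *)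
have hw' := weakR_swap hw.
have far' := far; rewrite addrC in far'.
have hu' := hu; rewrite addrC in hu'.
have hv' := hv; rewrite addrC in hv'.
have s0 := weakR_step0 hk hl far hu hv hw.
have s1 := weakR_step1 hk hl far hu hv hw.
have s2 := weakR_step2 hk hl far hu hv hw.
have s3 := weakR_step1 hl hk far' hv' hu' hw'.
have s4 := weakR_step2 hl hk far' hv' hu' hw'.
have [eu ev] := coordB_lattice z^-1 k l.
have [cu cv] := coordB_lattice c k l.
rewrite -ek -tanaka_mapE// in eu ev; rewrite -ek in cu cv.
split; first by rewrite sqnormE cu cv; lra.
rewrite /weak !ucoordV !vcoordV !sqnormE eu ev cu cv.
apply: weakR_inv.
- by rewrite -eu -ev; have := sqnorm_gt0 z10; rewrite sqnormE; lra.
- exact: s0.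
- by move=> /s1; rewrite intrD opprD addrA.
- by move=> /s2; rewrite intrB opprB [1%:~R - _]addrC addrA.
- by rewrite addrC => /s3; rewrite addrC intrD opprD addrA.
- by rewrite addrC => /s4; rewrite addrC intrB opprB [1%:~R - _]addrC addrA.
Qed.

End Dynamics.

(** * Strict pairs and injectivity of the action *)

Section Good.
Variable R : realType.
Implicit Types z w c : R[i].

(** Strict form of the condition: the boundary cases that would spoil the recovery of the digit are
    removed. *)
Definition good z w := [/\ weak z w^-1, 1 < sqnorm w,
  ucoord z^-1 != - (1 / 2) & vcoord z^-1 != - (1 / 2)].

Lemma div_eq_half (x n : R) : 0 < n -> x / n = - (1 / 2) -> n = - (2 * x).
Proof.
by move=> n0 e; have := divfK (lt0r_neq0 n0) x; rewrite e; lra.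
Qed.

Lemma inv_sqnorm_lt w : 1 < sqnorm w -> ucoord w^-1 ^+ 2 + vcoord w^-1 ^+ 2 < 1 / 2.
Proof.
move=> hw; have w0 : w != 0 by rewrite -sqnorm_eq0 gt_eqF// (lt_trans _ hw).
have : sqnorm w^-1 < 1 by rewrite sqnormV// invf_lt1// (lt_trans _ hw).
by rewrite sqnormE; lra.
Qed.

Lemma Qi_conj_step z w : ~ Qi z -> Qi_conj z w ->
  Qi_conj (tanaka_map z) (w^-1 - digit z).
Proof.
move=> hz hzw; rewrite tanaka_mapE ?not_Qi_neq0//.
by apply: Qi_conjB; [apply: Qi_digit|apply: Qi_conjV].
Qed.

(** The unit circle has rational coefficients, so with [w] it would contain [z], whose norm is below
    1. *)
Lemma sqnorm_conj_neq1 z w : tanakaX z -> ~ Qi z -> Qi_conj z w -> sqnorm w != 1.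
Proof.
move=> zX zQ zw; apply/eqP => w1.
have := @Qi_conj_circleR _ w z 0 0 (-1) (Qi_conj_irr zw zQ) (Qi_conj_sym zw).
rewrite rmorph0 rmorphN1 w1 !mul0r !addr0 subrr => /(_ erefl).
by have := tanakaX_sqnorm_lt1 zX zQ; lra.
Qed.

(** A coordinate -1/2 of the inverse puts the image on a circle through 0 with rational
    coefficients. Its conjugate is then on the same circle, which [weakR_noncircle] rules out. *)
Lemma noncircle_step z w : tanakaX z -> ~ Qi z -> Qi_conj z w -> weak z w^-1 ->
  1 < sqnorm w -> 1 < sqnorm (w^-1 - digit z) ->
  ucoord (tanaka_map z)^-1 != - (1 / 2) /\ vcoord (tanaka_map z)^-1 != - (1 / 2).
Proof.
move=> zX zQ zw hw w1 w1'.
have z1Q := tanaka_map_irr zQ; have z0 := not_Qi_neq0 zQ.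
have z1X := tanaka_map_X z0; have z10 := not_Qi_neq0 z1Q.
have zw' := Qi_conj_step zQ zw.
have [k [l [ek hk hl]]] := digitP z.
have [far hu hv] := inverse_bounds zX zQ.
have far' := far; rewrite addrC in far'.
have hu' := hu; rewrite addrC in hu'.
have hv' := hv; rewrite addrC in hv'.
have [eu ev] := coordB_lattice z^-1 k l; rewrite -ek -tanaka_mapE// in eu ev.
have [cu cv] := coordB_lattice w^-1 k l; rewrite -ek in cu cv.
have x1 := inv_sqnorm_lt w1.
have x1' := x1; rewrite addrC in x1'.
have p1 := tanakaX_sqnorm_lt1 z1X z1Q; rewrite sqnormE in p1.
have n1 := sqnorm_gt0 z10; rewrite sqnormE in n1.
rewrite sqnormE in w1'.
rewrite ucoordV vcoordV sqnormE; split; apply/eqP => e.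
- have e' : sqnorm (tanaka_map z) + ratr 0 * ucoord (tanaka_map z)
      + ratr 2 * vcoord (tanaka_map z) + ratr 0 = 0.
    by rewrite sqnormE (div_eq_half n1 e) rmorph0 (ratr_nat R 2); lra.
  have := Qi_conj_circleR z1Q zw' e'; move: e'.
  rewrite !sqnormE rmorph0 (ratr_nat R 2) => e1 e2.
  by apply: (weakR_noncircle hk hl far hu hv hw x1); rewrite -?eu -?ev -?cu -?cv; lra.
- have e' : sqnorm (tanaka_map z) + ratr 2 * ucoord (tanaka_map z)
      + ratr 0 * vcoord (tanaka_map z) + ratr 0 = 0.
    by rewrite sqnormE (div_eq_half n1 e) rmorph0 (ratr_nat R 2); lra.
  have := Qi_conj_circleR z1Q zw' e'; move: e'.
  rewrite !sqnormE rmorph0 (ratr_nat R 2) => e1 e2.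
  by apply: (weakR_noncircle hl hk far' hv' hu' (weakR_swap hw) x1');
    rewrite -?eu -?ev -?cu -?cv; lra.
Qed.

Lemma good_step z w : tanakaX z -> ~ Qi z -> Qi_conj z w -> good z w ->
  good (tanaka_map z) (w^-1 - digit z).
Proof.
move=> zX zQ zw [hw w1 _ _].
have [h1 h2] := weak_step zX zQ hw.
have z1X := tanaka_map_X (not_Qi_neq0 zQ).
have w1' : 1 < sqnorm (w^-1 - digit z).
  rewrite lt_neqAle h1 andbT eq_sym.
  exact: (sqnorm_conj_neq1 z1X (tanaka_map_irr zQ) (Qi_conj_step zQ zw)).
by have [] := noncircle_step zX zQ zw hw w1 w1'; split.
Qed.

(** The inverses of both components differ by the same lattice vector, so [weakR_digit_inj]
    applies. *)
Lemma good_inj z w z' w' : z != 0 -> z' != 0 -> good z w -> good z' w' ->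
  tanaka_map z = tanaka_map z' -> w^-1 - digit z = w'^-1 - digit z' ->
  z = z' /\ w = w'.
Proof.
move=> z0 z0' [h1 h2 /eqP h3 /eqP h4] [h1' h2' /eqP h3' /eqP h4'].
rewrite !tanaka_mapE// => ez ew.
have [k [l [ek _ _]]] := digitP z; have [k' [l' [ek' _ _]]] := digitP z'.
rewrite ek ek' in ez ew.
have [zu zv] := coordB_lattice z^-1 k l; have [zu' zv'] := coordB_lattice z'^-1 k' l'.
have [wu wv] := coordB_lattice w^-1 k l; have [wu' wv'] := coordB_lattice w'^-1 k' l'.
rewrite ez in zu zv; rewrite ew in wu wv.
have eu : ucoord z'^-1 = ucoord z^-1 + (k' - k)%:~R by rewrite intrB; lra.
have ev : vcoord z'^-1 = vcoord z^-1 + (l' - l)%:~R by rewrite intrB; lra.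
have fu : ucoord w'^-1 = ucoord w^-1 + (k' - k)%:~R by rewrite intrB; lra.
have fv : vcoord w'^-1 = vcoord w^-1 + (l' - l)%:~R by rewrite intrB; lra.
have g2 := inv_sqnorm_lt h2; have g2' := inv_sqnorm_lt h2'.
rewrite /weak eu ev fu fv in h1' h3' h4' g2'.
have [/eqP + /eqP] := weakR_digit_inj h1 g2 h1' g2' h3 h4 h3' h4'.
rewrite !subr_eq0 => /eqP ekk /eqP ell.
move: ez ew; rewrite ekk ell => /addIr/invr_inj -> /addIr/invr_inj ->.
by [].
Qed.

End Good.

(** * Escape from the vertices *)

Section Escape.
Variable R : realType.
Implicit Types z w e : R[i].

(** These are the points 1, -1, i and -i. *)
Definition vertex e := (ucoord e = 1 / 2 \/ ucoord e = - (1 / 2)) /\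
  (vcoord e = 1 / 2 \/ vcoord e = - (1 / 2)).

Lemma sqnorm_vertex e : vertex e -> sqnorm e = 1.
Proof. by move=> [hu hv]; rewrite sqnormE; case: hu hv => [->|->] [->|->]; field. Qed.

Lemma near_vertex z : tanakaX z -> 15 / 16 < sqnorm z ->
  exists2 e, vertex e & sqnorm (z - e) < 1 / 2.
Proof.
move=> /tanakaXE[/andP[u1 u2] /andP[v1 v2]]; rewrite sqnormE => hn.
have [hu|hu] := leP 0 (ucoord z); have [hv|hv] := leP 0 (vcoord z).
- exists (Complex 1 0); first by rewrite /vertex /ucoord /vcoord /=; split; left; field.
  have [] : ucoord (Complex 1 0 : R[i]) = 1 / 2 /\ vcoord (Complex 1 0 : R[i]) = 1 / 2.
    by rewrite /ucoord /vcoord /=; split; field.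
  by rewrite sqnormE !ucoordD !vcoordD !ucoordN !vcoordN => -> ->; nra.
- exists (Complex 0 1); first by rewrite /vertex /ucoord /vcoord /=; split; [left|right]; field.
  have [] : ucoord (Complex 0 1 : R[i]) = 1 / 2 /\ vcoord (Complex 0 1 : R[i]) = - (1 / 2).
    by rewrite /ucoord /vcoord /=; split; field.
  by rewrite sqnormE !ucoordD !vcoordD !ucoordN !vcoordN => -> ->; nra.
- exists (Complex 0 (-1)); first by rewrite /vertex /ucoord /vcoord /=; split; [right|left]; field.
  have [] : ucoord (Complex 0 (-1) : R[i]) = - (1 / 2) /\ vcoord (Complex 0 (-1) : R[i]) = 1 / 2.
    by rewrite /ucoord /vcoord /=; split; field.
  by rewrite sqnormE !ucoordD !vcoordD !ucoordN !vcoordN => -> ->; nra.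
- exists (Complex (-1) 0); first by rewrite /vertex /ucoord /vcoord /=; split; right; field.
  have [] : ucoord (Complex (-1) 0 : R[i]) = - (1 / 2) /\ vcoord (Complex (-1) 0 : R[i]) = - (1 / 2).
    by rewrite /ucoord /vcoord /=; split; field.
  by rewrite sqnormE !ucoordD !vcoordD !ucoordN !vcoordN => -> ->; nra.
Qed.

(** [a] and [b] are the coordinate distances to the two sides meeting at the vertex [e]; the two
    expressions are [|z - e|^2] and [|z|^2]. *)
Lemma corner_real (a b : R) : 0 <= a -> 0 <= b -> 2 * (a ^+ 2 + b ^+ 2) < 1 / 2 ->
  15 / 16 < 1 - 2 * (a + b) + 2 * (a ^+ 2 + b ^+ 2) ->
  2 * (a ^+ 2 + b ^+ 2) < 1 / 8 /\
  1 - 2 * (a + b) + 2 * (a ^+ 2 + b ^+ 2) <= 1 - (a ^+ 2 + b ^+ 2).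
Proof.
move=> a0 b0 h1 h2.
have ha : a <= 1 / 2 by nra.
have hb : b <= 1 / 2 by nra.
have ha2 : a ^+ 2 <= a / 2 by nra.
have hb2 : b ^+ 2 <= b / 2 by nra.
by split; lra.
Qed.

Lemma corner z e : tanakaX z -> vertex e -> sqnorm (z - e) < 1 / 2 ->
  15 / 16 < sqnorm z ->
  sqnorm (z - e) < 1 / 8 /\ sqnorm z <= 1 - sqnorm (z - e) / 2.
Proof.
move=> /tanakaXE[/andP[u1 u2] /andP[v1 v2]] [eu ev].
rewrite !sqnormE !ucoordD !vcoordD !ucoordN !vcoordN.
have key (a b p q : R) : a ^+ 2 = p ^+ 2 -> b ^+ 2 = q ^+ 2 -> 0 <= a -> 0 <= b ->
   2 * (p ^+ 2 + q ^+ 2) < 1 / 2 ->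
   15 / 16 < 2 * (ucoord z ^+ 2 + vcoord z ^+ 2) ->
   2 * (ucoord z ^+ 2 + vcoord z ^+ 2) = 1 - 2 * (a + b) + 2 * (p ^+ 2 + q ^+ 2) ->
   2 * (p ^+ 2 + q ^+ 2) < 1 / 8 /\
   2 * (ucoord z ^+ 2 + vcoord z ^+ 2) <= 1 - 2 * (p ^+ 2 + q ^+ 2) / 2.
  move=> <- <- a0 b0 h1 h2 h3; rewrite h3 in h2 *.
  by have [] := corner_real a0 b0 h1 h2; split; lra.
case: eu ev => [->|->] [->|->] h1 h2.
- by apply: (key (1 / 2 - ucoord z) (1 / 2 - vcoord z)) => //; [ring|ring|lra|lra|field].
- by apply: (key (1 / 2 - ucoord z) (1 / 2 + vcoord z)) => //; [ring|ring|lra|lra|field].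
- by apply: (key (1 / 2 + ucoord z) (1 / 2 - vcoord z)) => //; [ring|ring|lra|lra|field].
- by apply: (key (1 / 2 + ucoord z) (1 / 2 + vcoord z)) => //; [ring|ring|lra|lra|field].
Qed.

Lemma half_shift (x y : R) (k : int) : (x = 1 / 2 \/ x = - (1 / 2)) ->
  (y - x) ^+ 2 < 1 -> - (1 / 2) <= y - k%:~R < 1 / 2 ->
  x - k%:~R = 1 / 2 \/ x - k%:~R = - (1 / 2).
Proof.
move=> hx hy /andP[h1 h2].
have hd1 : y - x < 1 by nra.
have hd2 : -1 < y - x by nra.
case: hx => ex; rewrite ex in hd1 hd2 *.
- have : (-1 : int)%:~R < k%:~R :> R by rewrite rmorphN; lra.
  have : k%:~R < (2 : int)%:~R :> R by lra.
  rewrite !ltr_int => k1 k2.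
  have : k = 0 \/ k = 1 by lia.
  by case=> ->; [left|right]; lra.
- have : (-2 : int)%:~R < k%:~R :> R by rewrite rmorphN; lra.
  have : k%:~R < (1 : int)%:~R :> R by lra.
  rewrite !ltr_int => k1 k2.
  have : k = 0 \/ k = -1 by lia.
  by case=> ->; [right|left]; rewrite ?rmorphN; lra.
Qed.

(** Since |e| = 1, [|1/z - 1/e| = |z - e| / |z|]. The digit of [z] carries [1/e] to a vertex again,
    because the two inverses are close. *)
Lemma vertex_step z e : z != 0 -> vertex e -> sqnorm (z - e) < 1 / 8 ->
  15 / 16 < sqnorm z ->
  exists2 e1, vertex e1 & sqnorm (tanaka_map z - e1) = sqnorm (z - e) / sqnorm z.
Proof.
move=> z0 ev d1 d2; have e1 := sqnorm_vertex ev.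
have e0 : e != 0 by rewrite -sqnorm_eq0 e1 oner_eq0.
have dE : sqnorm (z^-1 - e^-1) = sqnorm (z - e) / sqnorm z.
  rewrite (_ : z^-1 - e^-1 = - (z - e) * (z^-1 * e^-1)); last by field; rewrite z0 e0.
  by rewrite !sqnormM sqnormN !sqnormV// e1 invr1 mulr1.
have hd : sqnorm (z^-1 - e^-1) < 2.
  by rewrite dE ltr_pdivrMr; lra.
have [k [l [ek hk hl]]] := digitP z.
exists (e^-1 - digit z); last by rewrite tanaka_mapE// -dE; congr sqnorm; ring.
have [eu' ev'] := coordB_lattice e^-1 k l.
rewrite -ek ucoordV e1 divr1 in eu'; rewrite -ek vcoordV e1 divr1 in ev'.
case: ev => hu hv.
move: hd; rewrite sqnormE !ucoordD !vcoordD !ucoordN !vcoordN ucoordV vcoordV.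
rewrite [ucoord e^-1]ucoordV [vcoord e^-1]vcoordV e1 !divr1 -ucoordV -vcoordV => hd.
have su := sqr_ge0 (ucoord z^-1 - vcoord e).
have sv := sqr_ge0 (vcoord z^-1 - ucoord e).
rewrite /vertex eu' ev'; split.
- by apply: half_shift hv _ hk; lra.
- by apply: half_shift hu _ hl; lra.
Qed.

Lemma orbit_X (n : nat) z : tanakaX z -> ~ Qi z ->
  tanakaX (iter n (@tanaka_map R) z) /\ ~ Qi (iter n (@tanaka_map R) z).
Proof.
move=> zX zQ; elim: n => [//|n [hX hQ]] /=; split.
  exact/tanaka_map_X/not_Qi_neq0.
exact: tanaka_map_irr.
Qed.

(* Near a vertex, [1 / |z - e|^2] drops by at least [1 / 2] at each step. *)
Lemma escape_vertex (m : nat) z e : tanakaX z -> ~ Qi z -> vertex e ->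
  sqnorm (z - e) < 1 / 2 -> (sqnorm (z - e))^-1 <= m%:R / 2 ->
  exists n, sqnorm (iter n (@tanaka_map R) z) <= 15 / 16.
Proof.
elim: m z e => [|m IH] z e zX zQ ev d1 hm.
all: have p0 : 0 < sqnorm (z - e) by apply/sqnorm_gt0; rewrite subr_eq0;
  apply/eqP => ez; have := tanakaX_sqnorm_lt1 zX zQ; rewrite ez sqnorm_vertex// ltxx.
  by move: hm; rewrite mul0r invr_le0; lra.
have [h|h] := leP (sqnorm z) (15 / 16); first by exists 0.
have z0 := not_Qi_neq0 zQ.
have [d2 hz] := corner zX ev d1 h.
have [e1 ev1 d3] := vertex_step z0 ev d2 h.
have [] := IH (tanaka_map z) e1 (tanaka_map_X z0) (tanaka_map_irr zQ) ev1.
- by rewrite d3 ltr_pdivrMr; lra.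
(* With [d = |z - e|^2], the bound [|z|^2 <= 1 - d/2] gives [|z|^2 / d <= 1/d - 1/2]. *)
- rewrite d3 invf_div; apply: (@le_trans _ _ ((sqnorm (z - e))^-1 - 1 / 2)).
    rewrite ler_pdivrMr// mulrBl mulVf ?gt_eqF//; lra.
  by move: hm; rewrite -natr1; lra.
by move=> n hn; exists n.+1; rewrite iterSr.
Qed.

Lemma escape z : tanakaX z -> ~ Qi z ->
  exists n, sqnorm (iter n (@tanaka_map R) z) <= 15 / 16.
Proof.
move=> zX zQ; have [h|h] := leP (sqnorm z) (15 / 16); first by exists 0.
have [e ev d] := near_vertex zX h.
pose x := (sqnorm (z - e))^-1.
apply: (@escape_vertex (Num.bound (2 * x)) z e) => //.
have := archi_boundP (x := 2 * x); rewrite mulr_ge0 ?invr_ge0 ?sqnorm_ge0// => /(_ erefl).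
by rewrite -/x; lra.
Qed.
End Escape.

(** * Integral forms and finiteness *)

Section Forms.
Variable R : realType.
Implicit Types z w c : R[i].

Definition gaussian_int z := exists a b : int, z = a%:~R +i* b%:~R.

Lemma gaussian_intD z w : gaussian_int z -> gaussian_int w -> gaussian_int (z + w).
Proof.
move=> [a [b ->]] [a' [b' ->]]; exists (a + a'), (b + b').
by rewrite !intrD.
Qed.
Lemma gaussian_intM z w : gaussian_int z -> gaussian_int w -> gaussian_int (z * w).
Proof.
move=> [a [b ->]] [a' [b' ->]]; exists (a * a' - b * b'), (a * b' + b * a').
by rewrite intrB intrD !intrM.
Qed.
Lemma gaussian_intN z : gaussian_int z -> gaussian_int (- z).
Proof. by move=> [a [b ->]]; exists (- a), (- b); rewrite !rmorphN. Qed.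

Lemma gaussian_int_int (k : int) : gaussian_int (k%:~R : R[i]).
Proof. by exists k, 0; rewrite complex_int. Qed.

Lemma gaussian_int_digit z : gaussian_int (digit z).
Proof.
have hi : gaussian_int ('i%C : R[i]) by exists 0, 1.
have h1 := gaussian_int_int 1.
by apply: gaussian_intD; apply: gaussian_intM (gaussian_int_int _) _;
  apply: gaussian_intD => //; apply: gaussian_intN.
Qed.

Lemma sqnorm_gaussian_int z : gaussian_int z -> z != 0 -> 1 <= sqnorm z.
Proof.
move=> [a [b ->]]; rewrite eq_complex /= !intr_eq0 => h.
rewrite /sqnorm /= -!rmorphXn -rmorphD /= (ler_int R 1).
by case/nandP: h => /eqP h; have := sqr_ge0 a; have := sqr_ge0 b; nia.
Qed.

Lemma Qi_denominator z : Qi z -> exists2 d : int, d != 0 & gaussian_int (d%:~R * z).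
Proof.
move=> /QiP[p [q [hp hq]]]; exists (denq p * denq q).
  by rewrite mulf_neq0 ?denq_neq0.
exists (numq p * denq q), (numq q * denq p).
have ratrd (r : rat) : (numq r)%:~R = ratr r * (denq r)%:~R :> R.
  by have := congr1 (@ratr R) (numqE r); rewrite rmorphM /= !ratr_int.
case: z hp hq => x y /= -> ->; rewrite complex_int !intrM !ratrd.
by apply/eqP; rewrite eq_complex /=; apply/andP; split; apply/eqP; ring.
Qed.

(* [A X^2 - A(z + w) X + A z w] has Gaussian integer coefficients and
   discriminant [D]. *)
Definition integral_form D z w A := [/\ gaussian_int A, A != 0,
  gaussian_int (A * (z + w)), gaussian_int (A * (z * w)) &
  A ^+ 2 * (z - w) ^+ 2 = D].

Lemma integral_form_exists z w : Qi_conj z w -> exists D A, integral_form D z w A.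
Proof.
move=> [/Qi_denominator[d d0 hd] /Qi_denominator[d' d'0 hd']].
exists ((d%:~R * d'%:~R) ^+ 2 * (z - w) ^+ 2), (d%:~R * d'%:~R).
have gi := gaussian_int_int.
split=> //; first exact: gaussian_intM.
- by rewrite mulf_neq0 ?intr_eq0.
- by rewrite [d%:~R * _]mulrC -mulrA; apply: gaussian_intM.
- by rewrite -mulrA; apply: gaussian_intM.
Qed.

(** Inverting the roots reverses the form, so its constant term becomes the leading coefficient;
    translation by a Gaussian integer keeps integrality and discriminant. *)
Lemma integral_form_step D z w A : z != 0 -> w != 0 -> integral_form D z w A ->
  integral_form D (tanaka_map z) (w^-1 - digit z) (A * (z * w)).
Proof.
move=> z0 w0 [hA A0 hS hP hD]; rewrite tanaka_mapE//.
have hd := gaussian_int_digit z; set a := digit z in hd *.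
split=> //; first by rewrite !mulf_neq0.
- rewrite (_ : _ * _ = A * (z + w) - (a + a) * (A * (z * w))); last first.
    by field; rewrite z0 w0.
  by apply: gaussian_intD => //; apply/gaussian_intN/gaussian_intM => //; apply: gaussian_intD.
- rewrite (_ : _ * _ = A - a * (A * (z + w)) + a * a * (A * (z * w))); last first.
    by field; rewrite z0 w0.
  apply: gaussian_intD; last by apply: gaussian_intM => //; apply: gaussian_intM.
  by apply: gaussian_intD => //; apply/gaussian_intN/gaussian_intM.
- by rewrite -hD; field; rewrite z0 w0.
Qed.

Lemma sqnormD_le z w : sqnorm (z + w) <= 2 * sqnorm z + 2 * sqnorm w.
Proof.
case: z w => a b [c d]; rewrite /sqnorm /=.
by have := sqr_ge0 (a - c); have := sqr_ge0 (b - d); nra.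
Qed.

Lemma sqnorm_gap z w : sqnorm z <= 15 / 16 -> 1 < sqnorm w -> 1 / 1000 <= sqnorm (z - w).
Proof.
case: z w => a b [c d]; rewrite /sqnorm /= => h1 h2.
(* The weight 30 gives [|w|^2 <= (31/30) |z|^2 + 31 |z - w|^2], hence [|z - w|^2 > 1/992]. *)
by have := sqr_ge0 (a + 30 * (a - c)); have := sqr_ge0 (b + 30 * (b - d)); nra.
Qed.

(** The discriminant fixes the product of [sqnorm A] and [sqnorm (z - w)]. The gap then bounds [A],
    and a large [w] makes [z - w] large and [A] small. The constant is 8 times 1000 plus 2, from
    [hzw]. *)
Lemma integral_form_bound D z w A : integral_form D z w A -> sqnorm z <= 15 / 16 ->
  1 < sqnorm w -> let K := 8002 * (1 + sqnorm D) in
  [/\ sqnorm A <= K, sqnorm (A * (z + w)) <= K & sqnorm (A * (z * w)) <= K].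
Proof.
move=> [hA A0 hS hP hD] hz hw K.
have A1 := sqnorm_gaussian_int hA A0.
have gap := sqnorm_gap hz hw.
have hs : sqnorm A * sqnorm (z - w) <= 1 + sqnorm D.
  have := congr1 (@sqnorm R) hD; rewrite -exprMn expr2 !sqnormM => <-.
  by set x := _ * _; have := sqr_ge0 (x - 1); nra.
have hw2 : sqnorm w <= 2 + 2 * sqnorm (z - w).
  have := sqnormD_le z (- (z - w)); rewrite sqnormN (_ : z + - (z - w) = w); last by ring.
  by lra.
have hzw : sqnorm (z + w) <= 8 + 2 * sqnorm (z - w).
  have := sqnormD_le (z + z) (- (z - w)); rewrite sqnormN (_ : z + z + - (z - w) = z + w); last by ring.
  by have := sqnormD_le z z; lra.
have hs0 := sqnorm_ge0 z; have hw0 : 0 <= sqnorm w := sqnorm_ge0 w.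
have hA2 : sqnorm A <= 1000 * (1 + sqnorm D) by nra.
rewrite !sqnormM /K; split.
- by have := sqnorm_ge0 D; lra.
- by nra.
- have : sqnorm z * sqnorm w <= sqnorm w by nra.
  by nra.
Qed.

(** Equal coefficients give the same unordered roots, and the unit circle tells them apart. *)
Lemma integral_form_inj z w z' w' A : A != 0 -> sqnorm z < 1 -> 1 < sqnorm w ->
  sqnorm z' < 1 -> 1 < sqnorm w' ->
  A * (z + w) = A * (z' + w') -> A * (z * w) = A * (z' * w') -> z = z' /\ w = w'.
Proof.
move=> A0 hz hw hz' hw' /(mulfI A0) hS /(mulfI A0) hP.
have : (z - z') * (z - w') = 0.
  rewrite (_ : _ * _ = z * z - (z' + w') * z + z' * w'); last by ring.
  by rewrite -hS -hP; ring.
move=> /eqP; rewrite mulf_eq0 !subr_eq0 => /orP[/eqP e|/eqP e].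
  by rewrite e in hS *; split=> //; apply: (addrI z').
by move: hz; rewrite e ltNge (ltW hw').
Qed.

Lemma gaussian_int_finite (K : R) : exists s : seq R[i],
  forall z, gaussian_int z -> sqnorm z <= K -> z \in s.
Proof.
pose M := Num.bound K.
pose I := [seq (i%:Z - M%:Z)%R | i <- iota 0 M.*2.+1].
exists [seq a%:~R +i* b%:~R | a <- I, b <- I] => z [a [b ->]] h; rewrite /sqnorm /= in h.
have mem (c : int) : (c%:~R : R) ^+ 2 <= K -> c \in I.
  move=> hc; have K0 : 0 <= K by apply: le_trans hc; apply: sqr_ge0.
  have hM := archi_boundP K0; rewrite -/M in hM.
  have : (c%:~R : R) ^+ 2 < (M%:Z)%:~R by apply: le_lt_trans hc _.
  rewrite -rmorphXn /= ltr_int => hcM.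
  have [h1 h2] : - M%:Z <= c /\ c <= M%:Z by split; nia.
  apply/mapP; exists (absz (c + M%:Z)); first by rewrite mem_iota; lia.
  by lia.
apply: allpairs_f; apply: mem.
- by have := sqr_ge0 (b%:~R : R); lra.
- by have := sqr_ge0 (a%:~R : R); lra.
Qed.

Lemma pigeonhole_seq (T : eqType) (s : seq T) (g : nat -> T) :
  (forall k, g k \in s) -> exists i j, (i < j)%N /\ g i = g j.
Proof.
move=> gs; pose t := [seq g k | k <- iota 0 (size s).+1].
have : ~~ uniq t.
  apply/negP => /uniq_leq_size ut.
  have : (size t <= size s)%N by apply: ut => x /mapP[k _ ->].
  by rewrite size_map size_iota ltnn.
move=> /(uniqPn (g 0%N))[i [j [ij jt]]]; rewrite size_map size_iota in jt.
rewrite !(nth_map 0%N) ?size_iota ?(ltn_trans ij)// !nth_iota ?(ltn_trans ij)// !add0n.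
by exists i, j.
Qed.

(** * Periodicity of reduced pairs *)

Definition conj_step (p : R[i] * R[i]) := (tanaka_map p.1, p.2^-1 - digit p.1).

Definition reduced (p : R[i] * R[i]) :=
  [/\ tanakaX p.1, ~ Qi p.1, Qi_conj p.1 p.2 & good p.1 p.2].

Lemma reduced_step p : reduced p -> reduced (conj_step p).
Proof.
move=> [h1 h2 h3 h4]; split.
- exact/tanaka_map_X/not_Qi_neq0.
- exact: tanaka_map_irr.
- exact: Qi_conj_step.
- exact: good_step.
Qed.

Lemma reduced_iter n p : reduced p -> reduced (iter n conj_step p).
Proof. by move=> hp; elim: n => //= n; apply: reduced_step. Qed.

Lemma conj_step_inj p p' : reduced p -> reduced p' -> conj_step p = conj_step p' -> p = p'.
Proof.
case: p p' => z w [z' w'] [_ zQ _ h] [_ zQ' _ h'] [] e1 e2.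
by have [/= -> ->] := good_inj (not_Qi_neq0 zQ) (not_Qi_neq0 zQ') h h' e1 e2.
Qed.

Lemma conj_step1 n p : (iter n conj_step p).1 = iter n (@tanaka_map R) p.1.
Proof. by elim: n => //= n ->. Qed.

Lemma integral_form_iter D n p A : reduced p -> integral_form D p.1 p.2 A ->
  exists A', integral_form D (iter n conj_step p).1 (iter n conj_step p).2 A'.
Proof.
move=> hp hA; elim: n => [|n [A' hA']]; first by exists A.
have [_ zQ zw _] := reduced_iter n hp.
exists (A' * ((iter n conj_step p).1 * (iter n conj_step p).2)).
by apply: integral_form_step => //; apply: not_Qi_neq0 => //; apply: Qi_conj_irr zw zQ.
Qed.

Lemma reduced_repeat p : reduced p ->
  exists i j, (i < j)%N /\ iter i conj_step p = iter j conj_step p.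
Proof.
move=> hp; have [_ _ pc _] := hp.
have [D [A0 hA0]] := integral_form_exists pc.
have hform n := integral_form_iter n hp hA0.
have hesc n : exists m, (n <= m)%N /\ sqnorm (iter m conj_step p).1 <= 15 / 16.
  have [hX hQ _ _] := reduced_iter n hp.
  have [m hm] := escape hX hQ; exists (m + n)%N; split; first exact: leq_addl.
  by rewrite iterD conj_step1.
have [h hh] := choice hesc; have [B hB] := choice hform.
(* [t] lists times at which the orbit is away from the vertices; each search starts just after the
   previous hit, so [t] is increasing. *)
pose s k := iter k (fun n => (h n).+1) 0%N.
pose t k := h (s k).
have tS : {homo t : i j / (i < j)%N}.
  by apply: homo_ltn => [j i k|k]; [apply: ltn_trans|have [] := hh (s k.+1)].
pose p_ k := iter (t k) conj_step p.
pose g k := (B (t k), B (t k) * ((p_ k).1 + (p_ k).2), B (t k) * ((p_ k).1 * (p_ k).2)).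
have [l hl] := gaussian_int_finite (8002 * (1 + sqnorm D)).
have [|i [j [ij gij]]] := @pigeonhole_seq _
    [seq (xy, x) | xy <- [seq (x, y) | x <- l, y <- l], x <- l] g.
  move=> k; have [_ hk] := hh (s k); have [_ _ _ [_ hw _ _]] := reduced_iter (t k) hp.
  have hBk := hB (t k); have [b1 b2 b3] := integral_form_bound hBk hk hw.
  have [c1 _ c2 c3 _] := hBk.
  by apply: allpairs_f; [apply: allpairs_f|]; apply: hl.
exists (t i), (t j); split; first exact: tS.
have ri := reduced_iter (t i) hp; have rj := reduced_iter (t j) hp.
have [_ Bi0 _ _ _] := hB (t i).
move: gij; rewrite /g /p_ => -[] eB; rewrite -eB => e1 e2.
have [Xi Qi_ _ [_ wi _ _]] := ri; have [Xj Qj _ [_ wj _ _]] := rj.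
have [] := integral_form_inj Bi0 (tanakaX_sqnorm_lt1 Xi Qi_) wi
  (tanakaX_sqnorm_lt1 Xj Qj) wj e1 e2.
by case: (iter (t i) _ _) => ? ?; case: (iter (t j) _ _) => ? ? /= -> ->.
Qed.

Lemma reduced_periodic p : reduced p -> exists2 l, (0 < l)%N & iter l conj_step p = p.
Proof.
move=> hp; have [i [j [ij e]]] := reduced_repeat hp.
exists (j - i)%N; first by rewrite subn_gt0.
move: e; rewrite -{1}(subnKC (ltnW ij)) iterD.
have hq := reduced_iter (j - i) hp; move: (iter (j - i) _ _) hq => q hq.
(* Injectivity cancels the common steps one by one, turning preperiodicity into pure periodicity. *)
elim: i {ij} => [//|i IH] /= /conj_step_inj e.
by apply/IH/e; apply: reduced_iter.
Qed.

End Forms.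

(** * Periodic orbits *)

Section Limits.
Variable R : realType.
Implicit Types x y z w c t : R[i].

Lemma expr_small (x M e : R) : 0 <= x < 1 -> 0 <= M -> 0 < e ->
  exists k, M * x ^+ k < e.
Proof.
move=> /andP[x0 x1] M0 e0.
(* A Bernoulli-type bound, which reduces the decay of powers to the archimedean property. *)
have bern k : x ^+ k * (1 + k%:R * (1 - x)) <= 1.
  elim: k => [|k IH]; first by rewrite expr0 mul0r addr0 mulr1.
  apply: le_trans IH; rewrite exprSr -mulrA ler_wpM2l ?exprn_ge0// -natr1.
  have : 0 <= (k%:R : R) * (1 - x) ^+ 2 by rewrite mulr_ge0 ?sqr_ge0.
  by have := sqr_ge0 (1 - x); lra.
pose K := M / (e * (1 - x)).
have K0 : 0 <= K by rewrite divr_ge0// mulr_ge0; lra.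
have := archi_boundP K0; set k := Num.bound _ => hk; exists k.
rewrite ltr_pdivrMr in hk; last by rewrite mulr_gt0; lra.
have hp : 0 < 1 + k%:R * (1 - x).
  by have : 0 <= (k%:R : R) * (1 - x); [rewrite mulr_ge0//; lra|lra].
rewrite -(ltr_pM2r hp) -mulrA.
apply: (@le_lt_trans _ _ M); last by lra.
by rewrite -[leRHS]mulr1 ler_wpM2l.
Qed.

(** Weighted triangle inequality, by completing a square; it lets limits be taken on squared
    norms. *)
Lemma sqnorm_young x y (s : R) : 0 < s ->
  sqnorm y <= (1 + s) * sqnorm x + (1 + s^-1) * sqnorm (x - y).
Proof.
move=> s0; rewrite -subr_ge0.
have -> : (1 + s) * sqnorm x + (1 + s^-1) * sqnorm (x - y) - sqnorm y =
   s^-1 * sqnorm (s%:C * x + (x - y)).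
  case: x y => a b [c d]; rewrite /sqnorm /=; field; lra.
by rewrite mulr_ge0 ?sqnorm_ge0// invr_ge0 ltW.
Qed.

Lemma sqnorm_le1_lim x : (forall e : R, 0 < e ->
  exists2 y, sqnorm y <= 1 & sqnorm (x - y) < e) -> sqnorm x <= 1.
Proof.
move=> h; rewrite leNgt; apply/negP => x1.
(* Then [sqnorm x = 1 + 2s], while the weighted inequality gives less than [(1 + s) + s]. *)
pose s := (sqnorm x - 1) / 2.
have s0 : 0 < s by rewrite /s; lra.
have c0 : 0 < 1 + s^-1 by rewrite addr_gt0// invr_gt0.
have [|y hy hxy] := h (s / (1 + s^-1)); first exact: divr_gt0.
have hx := sqnorm_young y x s0; rewrite -[y - x]opprB sqnormN in hx.
rewrite ltr_pdivlMr// in hxy.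
have : (1 + s) * sqnorm y <= 1 + s by rewrite -[leRHS]mulr1 ler_wpM2l//; lra.
by rewrite /s in hx hxy *; lra.
Qed.

Lemma sqnorm_ge1_lim x : (forall e : R, 0 < e ->
  exists2 y, 1 <= sqnorm y & sqnorm (x - y) < e) -> 1 <= sqnorm x.
Proof.
move=> h; rewrite leNgt; apply/negP => x1.
(* Then [sqnorm x = 1 - 2s], and the weighted inequality bounds [sqnorm y] by
   [(1 + s)(1 - 2s) + s = 1 - 2s^2]. *)
pose s := (1 - sqnorm x) / 2.
have s0 : 0 < s by rewrite /s; lra.
have c0 : 0 < 1 + s^-1 by rewrite addr_gt0// invr_gt0.
have [|y hy hxy] := h (s / (1 + s^-1)); first exact: divr_gt0.
have := sqnorm_young x y s0 => hx.
rewrite ltr_pdivlMr// in hxy.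
have hs : sqnorm x = 1 - 2 * s by rewrite /s; lra.
rewrite hs in hx.
have : 0 <= s * s by rewrite mulr_ge0 ?ltW.
rewrite [_ * sqnorm (x - y)]mulrC in hx.
by move: (sqnorm (x - y) * _) hxy hx => D; nra.
Qed.
End Limits.

(** * Convergent denominators along a periodic orbit *)

Section Periodic.
Variable R : realType.
Implicit Types z w c : R[i].
Local Notation T := (@tanaka_map R).

(* [dual_orbit z n] is [- q_{n-1} / q_n] for the denominators [q_n] of the
   convergents of [z]. *)
Fixpoint dual_orbit z n : R[i] :=
  if n is m.+1 then (dual_orbit z m - digit (iter m T z))^-1 else 0.

(** The recursion is the action on [1 / beta] started at 0, where the condition is clear;
    [weak_step] propagates it. *)
Lemma dual_orbit_weak z n : tanakaX z -> ~ Qi z ->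
  weak (iter n T z) (dual_orbit z n).
Proof.
move=> zX zQ; elim: n => [|n IH] /=.
  rewrite /weak /= /ucoord /vcoord /= addr0 subr0 mul0r.
  by split; lra.
have [hX hQ] := orbit_X n zX zQ.
by have [] := weak_step hX hQ IH.
Qed.

Lemma dual_orbit_den z n : tanakaX z -> ~ Qi z ->
  dual_orbit z n - digit (iter n T z) != 0.
Proof.
move=> zX zQ; have [hX hQ] := orbit_X n zX zQ.
have [h _] := weak_step hX hQ (dual_orbit_weak n zX zQ).
by rewrite -sqnorm_eq0 gt_eqF// (lt_le_trans _ h).
Qed.

Lemma Qi_dual_orbit z n : Qi (dual_orbit z n).
Proof.
elim: n => [|n IH] /=; first exact: Qi_0.
by apply/QiV/QiB => //; apply: Qi_digit.
Qed.

(** With [x] the n-th iterate this is [z = (p_n + p_{n-1} x) / (q_n + q_{n-1} x)], for [P = p_n],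
    [Q = - p_{n-1}], [q = q_n]. *)
Lemma orbit_homography z n : tanakaX z -> ~ Qi z -> exists P Q q,
  [/\ Qi P, Qi Q, Qi q, q != 0 &
      z * (q * (1 - dual_orbit z n * iter n T z)) = P - Q * iter n T z].
Proof.
move=> zX zQ; elim: n => [|n [P [Q [q [hP hQ hq q0 e]]]]].
  exists 0, (-1), 1; split; rewrite ?oner_eq0//=; last by ring.
  - exact: Qi_0.
  - exact/QiN/Qi_1.
  - exact: Qi_1.
have [_ nQ] := orbit_X n zX zQ; have n0 := not_Qi_neq0 nQ.
have hd := Qi_digit (iter n T z); have hc := Qi_dual_orbit z n.
have den := dual_orbit_den n zX zQ.
rewrite /= tanaka_mapE//; move: hd hc den e n0.
set a := digit _; set c := dual_orbit z n; set x := iter n T z => hd hc den e n0.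
exists (P * a - Q), (- P), (q * (a - c)); split.
- by apply: QiB => //; apply: QiM.
- exact: QiN.
- by apply: QiM => //; apply: QiB.
- by rewrite mulf_neq0// -opprB oppr_eq0.
- rewrite (_ : z * _ = (z * (q * (1 - c * x))) / x); last first.
    by field; rewrite n0 den.
  by rewrite e; field.
Qed.

(** At a period the homography fixes [z], making it a root of [q c X^2 - (q + Q) X + P] with [c] the
    dual orbit; the other root is read off from the trace. *)
Lemma periodic_conj z l : tanakaX z -> ~ Qi z -> (0 < l)%N -> iter l T z = z ->
  exists w, Qi_conj z w.
Proof.
move=> zX zQ l0 ez; have [P [Q [q [hP hQ hq q0]]]] := orbit_homography l zX zQ.
rewrite ez; have hc := Qi_dual_orbit z l.
have : dual_orbit z l != 0.
  by case: l l0 {ez hc} => // l _ /=; rewrite invr_eq0 dual_orbit_den.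
move: (dual_orbit z l) hc => c hc c0 e.
exists ((q + Q) / (q * c) - z); split.
  rewrite addrC subrK; apply: Qi_div; first exact: QiD.
  exact: QiM.
rewrite (_ : z * _ = P / (q * c)); first by apply: Qi_div => //; apply: QiM.
have -> : P = z * (q * (1 - c * z)) + Q * z by rewrite e subrK.
by field; rewrite q0 c0.
Qed.

Lemma conj_iter n p : ~ Qi p.1 -> Qi_conj p.1 p.2 ->
  ~ Qi (iter n (@conj_step R) p).1 /\
  Qi_conj (iter n (@conj_step R) p).1 (iter n (@conj_step R) p).2.
Proof.
move=> pQ pc; elim: n => [//|n [IH1 IH2]] /=; split.
  exact: tanaka_map_irr.
exact: Qi_conj_step.
Qed.

Lemma conj_periodic z w l : ~ Qi z -> Qi_conj z w -> iter l T z = z ->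
  iter l (@conj_step R) (z, w) = (z, w).
Proof.
move=> zQ zw ez; have [] := @conj_iter l (z, w) zQ zw.
have := conj_step1 l (z, w); case: (iter l _ _) => z' w' /= ->.
by rewrite ez => _ /(Qi_conj_uniq zQ zw) <-.
Qed.

Lemma iter_mul (S : Type) (f : S -> S) l k x : iter l f x = x -> iter (k * l) f x = x.
Proof. by move=> e; elim: k => [//|k IH]; rewrite mulSn iterD IH e. Qed.

(** For the current pair [(x, y)], each step multiplies [(1 - y c) / (1 - x c)] by [x / y] and
    [x - y] by [-1 / (x y)], so the quotient of the two gains the factor [- x^2]. *)
Lemma dual_orbit_gap z w n : tanakaX z -> ~ Qi z -> Qi_conj z w ->
  let p := iter n (@conj_step R) (z, w) in
  sqnorm (1 - p.2 * dual_orbit z n) * sqnorm (z - w) =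
  sqnorm (1 - p.1 * dual_orbit z n) * sqnorm (p.1 - p.2)
    * (\prod_(j < n) sqnorm (iter j T z)) ^+ 2.
Proof.
move=> zX zQ zw; elim: n => [|n IH].
  by rewrite /= !mulr0 big_ord0 expr1n mulr1.
have [nQ nc] := @conj_iter n (z, w) zQ zw.
have x0 := not_Qi_neq0 nQ; have y0 := not_Qi_neq0 (Qi_conj_irr nc nQ).
have den := dual_orbit_den n zX zQ.
have e1 := conj_step1 n (z, w); rewrite /= in e1.
rewrite /= tanaka_mapE// big_ord_recr /= -e1.
rewrite -e1 in den.
move: IH x0 y0 den; case: (iter n _ _) => x y /=.
set c := dual_orbit z n; set a := digit x; set d := z - w.
move: (\prod_(_ < _) _) => rho IH x0 y0 den.
have -> : 1 - (y^-1 - a) / (c - a) = - (1 - y * c) / (y * (c - a)).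
  by field; rewrite y0 den.
have -> : 1 - (x^-1 - a) / (c - a) = - (1 - x * c) / (x * (c - a)).
  by field; rewrite x0 den.
have -> : x^-1 - a - (y^-1 - a) = - (x - y) / (x * y) by field; rewrite x0 y0.
rewrite !sqnormM !sqnormV ?mulf_neq0// !sqnormN !sqnormM.
rewrite -!sqnorm_eq0 in x0 y0 den.
have -> : forall u v, u / v * sqnorm d = u * sqnorm d / v by move=> u v; rewrite mulrAC.
by rewrite IH; field; rewrite x0 y0 den.
Qed.

(** All factors are below 1, and each period contains the factor of [z] itself. *)
Lemma prod_orbit_le z l k : tanakaX z -> ~ Qi z -> (0 < l)%N -> iter l T z = z ->
  \prod_(j < k * l) sqnorm (iter j T z) <= sqnorm z ^+ k.
Proof.
move=> zX zQ l0 ez; elim: k => [|k IH]; first by rewrite mul0n big_ord0.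
have le1 m j : \prod_(i < m + j) sqnorm (iter i T z) <= \prod_(i < m) sqnorm (iter i T z).
  elim: j => [|j IHj]; first by rewrite addn0.
  rewrite addnS big_ord_recr /=; apply: le_trans IHj.
  have [hX hQ] := orbit_X (m + j) zX zQ.
  by rewrite ler_piMr ?prodr_ge0 ?ltW ?tanakaX_sqnorm_lt1// => i _; apply: sqnorm_ge0.
rewrite mulSn addnC -(prednK l0) addnS -addSn; apply: le_trans (le1 _ _) _.
rewrite prednK// big_ord_recr /= iter_mul// exprSr.
by rewrite ler_wpM2r ?sqnorm_ge0.
Qed.

(** At multiples of the period the pair is back at [(z, w)], so [z - w] cancels in [dual_orbit_gap]
    and [1 - w c] decays like a power of [sqnorm z]. *)
Lemma dual_orbit_lim z w l : tanakaX z -> ~ Qi z -> Qi_conj z w ->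
  (0 < l)%N -> iter l T z = z -> forall e : R, 0 < e ->
  exists k, sqnorm (w^-1 - dual_orbit z (k * l)) < e.
Proof.
move=> zX zQ zw l0 ez e e0.
have w0 := not_Qi_neq0 (Qi_conj_irr zw zQ).
have z1 := tanakaX_sqnorm_lt1 zX zQ; have z0 := sqnorm_ge0 z.
have M0 : 0 <= 4 * sqnorm w^-1 by rewrite mulr_ge0 ?sqnorm_ge0.
have [|k hk] := @expr_small R (sqnorm z) _ e _ M0 e0; first by rewrite z0.
exists k; apply: le_lt_trans hk.
have := dual_orbit_gap (k * l) zX zQ zw; rewrite /= iter_mul ?conj_periodic//=.
have hw := dual_orbit_weak (k * l) zX zQ.
have := prod_orbit_le k zX zQ l0 ez.
have prod0 : 0 <= \prod_(j < k * l) sqnorm (iter j T z).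
  by apply: prodr_ge0 => i _; apply: sqnorm_ge0.
move: hw prod0 => [+ _ _ _ _]; move: (dual_orbit z _) (\prod_(_ < _) _) => c rho.
move=> hc rho0 hrho eq.
have dn : sqnorm (z - w) != 0 by rewrite sqnorm_eq0 subr_eq0 Qi_conj_neq.
have {}eq : sqnorm (1 - w * c) = sqnorm (1 - z * c) * rho ^+ 2.
  by apply: (mulIf dn); rewrite eq; ring.
rewrite (_ : w^-1 - c = w^-1 * (1 - w * c)); last by field.
rewrite sqnormM eq.
have c4 : sqnorm (1 - z * c) <= 4.
  have := sqnormD_le 1 (- (z * c)); rewrite sqnormN sqnormM sqnorm1.
  have cn : sqnorm c <= 1 by rewrite sqnormE; lra.
  have : sqnorm z * sqnorm c <= 1 by apply: mulr_ile1; rewrite ?sqnorm_ge0// ltW.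
  by lra.
have x1 : sqnorm z ^+ k <= 1 by rewrite exprn_ile1// ltW.
have rho2 : rho ^+ 2 <= sqnorm z ^+ k by nra.
rewrite [4 * _]mulrC -mulrA ler_wpM2l ?sqnorm_ge0// ler_pM ?sqnorm_ge0 ?sqr_ge0//.
Qed.

(** Along multiples of the period the side conditions on [z] stay the same, and the closed
    conditions on the dual orbit pass to its limit [1 / w]. *)
Lemma periodic_weak z w l : tanakaX z -> ~ Qi z -> Qi_conj z w ->
  (0 < l)%N -> iter l T z = z -> weak z w^-1 /\ 1 < sqnorm w.
Proof.
move=> zX zQ zw l0 ez.
have lim := dual_orbit_lim zX zQ zw l0 ez.
have hw k : weak z (dual_orbit z (k * l)).
  by have := dual_orbit_weak (k * l) zX zQ; rewrite iter_mul.
have w0 := not_Qi_neq0 (Qi_conj_irr zw zQ).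
have b1 : sqnorm w^-1 <= 1.
  apply: sqnorm_le1_lim => e /lim[k hk]; exists (dual_orbit z (k * l)) => //.
  by have [+ _ _ _ _] := hw k; rewrite sqnormE; lra.
have far m n : (forall k, 1 / 2 <= (ucoord (dual_orbit z (k * l)) - m%:~R) ^+ 2
      + (vcoord (dual_orbit z (k * l)) - n%:~R) ^+ 2) ->
    1 / 2 <= (ucoord w^-1 - m%:~R) ^+ 2 + (vcoord w^-1 - n%:~R) ^+ 2.
  move=> h; have [eu ev] := coordB_lattice w^-1 m n.
  suff : 1 <= sqnorm (w^-1 - gauss_lattice R m n) by rewrite sqnormE eu ev; lra.
  apply: sqnorm_ge1_lim => e /lim[k hk].
  exists (dual_orbit z (k * l) - gauss_lattice R m n).
    have [eu' ev'] := coordB_lattice (dual_orbit z (k * l)) m n.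
    by rewrite sqnormE eu' ev'; have := h k; lra.
  by rewrite (_ : _ - _ - _ = w^-1 - dual_orbit z (k * l)) //; ring.
split.
- split; first by move: b1; rewrite sqnormE; lra.
  + move=> hz; rewrite -[vcoord _]subr0; apply: (far 1 0) => k.
    by rewrite subr0; have [_ h _ _ _] := hw k; apply: h.
  + move=> hz; have := far (-1) 0; rewrite rmorphN opprK subr0; apply => k.
    by rewrite subr0; have [_ _ h _ _] := hw k; apply: h.
  + move=> hz; rewrite -[ucoord _]subr0; apply: (far 0 1) => k.
    by rewrite subr0; have [_ _ _ h _] := hw k; apply: h.
  + move=> hz; have := far 0 (-1); rewrite rmorphN opprK subr0; apply => k.
    by rewrite subr0; have [_ _ _ _ h] := hw k; apply: h.
- rewrite lt_neqAle eq_sym (sqnorm_conj_neq1 zX zQ zw) /=.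
  by move: b1; rewrite sqnormV// invf_le1 ?sqnorm_gt0.
Qed.

(** The pair is the image of its predecessor in the cycle, which is periodic too, so
    [noncircle_step] supplies the strict part. *)
Lemma periodic_good z w l : tanakaX z -> ~ Qi z -> Qi_conj z w ->
  (0 < l)%N -> iter l T z = z -> good z w.
Proof.
move=> zX zQ zw l0 ez.
have [hw w1] := periodic_weak zX zQ zw l0 ez.
have ep := conj_periodic zQ zw ez.
have [x'X x'Q] := orbit_X l.-1 zX zQ.
have [_ xc] := @conj_iter l.-1 (z, w) zQ zw.
have e1 := conj_step1 l.-1 (z, w).
have ex : iter l T (iter l.-1 T z) = iter l.-1 T z by rewrite -iterD addnC iterD ez.
move: ep; rewrite -{1}(prednK l0) iterS.
move: e1 xc; case: (iter l.-1 _ _) => x y /= e1 xc [zE wE].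
rewrite -e1 in x'X x'Q ex.
have [hx y1] := periodic_weak x'X x'Q xc l0 ex.
have := noncircle_step x'X x'Q xc hx y1; rewrite zE wE => /(_ w1)[].
by split.
Qed.
End Periodic.

(** * Sequences and minimal polynomials *)

Section Sequence.
Variable R : realType.
Local Notation T := (@tanaka_map R).

Lemma tanaka_seqE (z : R[i]) n : ~ Qi z -> tanaka_seq z n = Some (iter n.-1 T z).
Proof.
move=> zQ; rewrite /tanaka_seq; elim: n.-1 => [//|m IH]; rewrite !iterS IH /=.
have hm : ~ Qi (iter m T z) by elim: m {IH} => //= m; apply: tanaka_map_irr.
by rewrite (negPf (not_Qi_neq0 hm)).
Qed.

Lemma purely_periodicE (z : R[i]) : ~ Qi z ->
  purely_periodic z <-> exists2 l, (0 < l)%N & iter l T z = z.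
Proof.
move=> zQ; split=> [[_ [l [l0 h]]]|[l l0 e]].
  exists l => //; have := h 1%N isT; rewrite !tanaka_seqE// add1n /=.
  by case.
split=> [n _|]; first by rewrite tanaka_seqE.
exists l; split=> // -[//|n] _; rewrite !tanaka_seqE// addSn /=.
by rewrite iterD e.
Qed.
End Sequence.

Section MinimalPolynomial.
Variable R : realType.
Implicit Types z w : R[i].

Lemma quadraticE z w : ('X - z%:P) * ('X - w%:P) =
  'X^2 - (z + w) *: 'X + (z * w)%:P :> {poly R[i]}.
Proof. by rewrite -mul_polyC rmorphD rmorphM /=; ring. Qed.

Lemma size_quadratic z w : size (('X - z%:P) * ('X - w%:P)) = 3%N.
Proof. by rewrite size_Mmonic ?monicXsubC ?polyXsubC_eq0// !size_XsubC. Qed.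

Lemma Qi_conjugateE z w : ~ Qi z -> Qi_conjugate z w <-> Qi_conj z w.
Proof.
move=> zQ; rewrite /Qi_conjugate /Qi_minpoly.
split=> [[_ h _ _]|[hS hP]].
  have := h 0%N; have := h 1%N; rewrite quadraticE !coefE /= !(mulr1, mulr0, add0r, addr0, subr0, oppr0).
  move=> hS hP; split => //.
  by rewrite -[_ + _]opprK; apply: QiN.
split.
- by rewrite monicMl ?monicXsubC.
- move=> k; rewrite quadraticE !coefE.
  case: k => [|[|[|k]]] /=; rewrite !(mulr1, mulr0, add0r, addr0, subr0, oppr0) //.
  + exact: QiN.
  + exact: Qi_1.
  + exact: Qi_0.
- by rewrite rootM root_XsubC eqxx.
(* A polynomial of smaller size would be a linear relation for [z] over Q(i). *)
- move=> q q0 hq; rewrite size_quadratic ltnNge => hr; apply/negP => sq.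
  have e : q`_1 * z + q`_0 = 0.
    move: hr; rewrite /root (horner_coef_wide _ sq) !big_ord_recl big_ord0 /= => /eqP; apply: etrans.
    by rewrite expr0 mulr1 addr0 addrC.
  have q1 := Qi_linear_eq0 zQ (hq 1%N) (hq 0%N) e.
  move: e; rewrite q1 mul0r add0r => q00.
  move: q0; rewrite -lead_coef_eq0 lead_coefE.
  by case: (size q) sq => [|[|[|//]]] _ /=; rewrite ?q1 ?q00 eqxx.
Qed.

Lemma Qi_conjugate_quadratic z w : Qi_conjugate z w -> quadratic_irrational z.
Proof. by move=> h; exists (('X - z%:P) * ('X - w%:P)); rewrite size_quadratic. Qed.
End MinimalPolynomial.

(** * Circles and discs under inversion *)

Section Geometry.
Variable R : realType.
Implicit Types z w c : R[i].

Lemma norm_ge_sqnorm z (r : R) : 0 <= r -> (r%:C <= `|z|) = (r ^+ 2 <= sqnorm z).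
Proof.
move=> r0; rewrite norm_sqnorm lecR -[X in X <= _](ger0_norm r0) -sqrtr_sqr.
by rewrite ler_sqrt ?sqnorm_ge0.
Qed.

Lemma norm_eq_sqnorm z (r : R) : 0 <= r -> `|z| = r%:C <-> sqnorm z = r ^+ 2.
Proof.
move=> r0; rewrite norm_sqnorm; split=> [[]/(congr1 (fun x => x ^+ 2))|->].
  by rewrite sqr_sqrtr ?sqnorm_ge0.
by rewrite sqrtr_sqr ger0_norm.
Qed.

Lemma norm_gt1 z : (1 < `|z|) = (1 < sqnorm z).
Proof. by rewrite (@norm_gt_sqnorm R z 1)// expr1n. Qed.
Lemma norm_ge1 z : (1 <= `|z|) = (1 <= sqnorm z).
Proof. by rewrite (@norm_ge_sqnorm z 1)// expr1n. Qed.

Lemma sqrt2_half_ge0 : 0 <= Num.sqrt 2 / 2 :> R.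
Proof. by rewrite divr_ge0 ?sqrtr_ge0. Qed.
Lemma sqrt2_half_sqr : (Num.sqrt 2 / 2) ^+ 2 = 1 / 2 :> R.
Proof. by rewrite expr_div_n sqr_sqrtr//; field. Qed.

Lemma norm_gt_half z : (sqrt2_half R < `|z|) = (1 / 2 < sqnorm z).
Proof. by rewrite norm_gt_sqnorm ?sqrt2_half_ge0// sqrt2_half_sqr. Qed.
Lemma norm_lt_half z : (`|z| < sqrt2_half R) = (sqnorm z < 1 / 2).
Proof. by rewrite norm_lt_sqnorm ?sqrt2_half_ge0// sqrt2_half_sqr. Qed.
Lemma norm_eq_half z : `|z| = sqrt2_half R <-> sqnorm z = 1 / 2.
Proof. by rewrite norm_eq_sqnorm ?sqrt2_half_ge0// sqrt2_half_sqr. Qed.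

Lemma ucoord_mul_i z : ucoord ('i%C * z) = vcoord z.
Proof. by case: z => x y; rewrite /ucoord /vcoord /=; field. Qed.
Lemma vcoord_mul_i z : vcoord ('i%C * z) = - ucoord z.
Proof. by case: z => x y; rewrite /ucoord /vcoord /=; field. Qed.

Lemma mul_coordV z : z != 0 -> ucoord z = vcoord z^-1 * sqnorm z /\
  vcoord z = ucoord z^-1 * sqnorm z.
Proof.
by move=> z0; rewrite ucoordV vcoordV !divfK ?sqnorm_eq0.
Qed.

(** The circle of radius sqrt 2 / 2 about [c] passes through 0, so inversion makes it a line; the
    last factor is its equation in [1 / z]. *)
Lemma sqnorm_center z c : z != 0 -> ucoord c ^+ 2 + vcoord c ^+ 2 = 1 / 4 ->
  sqnorm (z - c) = 1 / 2 +
    sqnorm z * (1 - 4 * (ucoord c * vcoord z^-1 + vcoord c * ucoord z^-1)).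
Proof.
move=> z0 hc; have [hu hv] := mul_coordV z0; have hn := sqnormE z.
rewrite sqnormE !ucoordD !vcoordD !ucoordN !vcoordN; move: hn hu hv hc.
move: (sqnorm z) (ucoord z) (vcoord z) (ucoord c) (vcoord c) (ucoord z^-1) (vcoord z^-1).
move=> n u v p q U V hn hu hv hc.
have -> : n * (1 - 4 * (p * V + q * U)) = n - 4 * (p * (V * n) + q * (U * n)).
  by ring.
rewrite -hu -hv hn.
have -> : 2 * ((u - p) ^+ 2 + (v - q) ^+ 2) =
  2 * (p ^+ 2 + q ^+ 2) + 2 * (u ^+ 2 + v ^+ 2) - 4 * (p * u + q * v) by ring.
by rewrite hc; field.
Qed.

(** Here |c| = sqrt 2, so the unit circle about [c] is orthogonal to the one about 0 and keeps its
    form in [1 / z]. *)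
Lemma sqnorm_ball z c : z != 0 -> ucoord c ^+ 2 + vcoord c ^+ 2 = 1 ->
  sqnorm (z - c) = 1 + 2 * sqnorm z *
   ((ucoord z^-1 - vcoord c) ^+ 2 + (vcoord z^-1 - ucoord c) ^+ 2 - 1 / 2).
Proof.
move=> z0 hc; have [hu hv] := mul_coordV z0; have hn := sqnormE z.
have hn' : 2 * sqnorm z * (ucoord z^-1 ^+ 2 + vcoord z^-1 ^+ 2) = 1.
  have := sqnormE z^-1; rewrite sqnormV// => e.
  have := mulfV (_ : sqnorm z != 0); rewrite sqnorm_eq0 e => /(_ z0); lra.
rewrite sqnormE !ucoordD !vcoordD !ucoordN !vcoordN; move: hn hu hv hc hn'.
move: (sqnorm z) (ucoord z) (vcoord z) (ucoord c) (vcoord c) (ucoord z^-1) (vcoord z^-1).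
move=> n u v p q U V hn hu hv hc hn'.
have -> : 1 + 2 * n * ((U - q) ^+ 2 + (V - p) ^+ 2 - 1 / 2) =
  1 + 2 * n * (U ^+ 2 + V ^+ 2) - 4 * (q * (U * n) + p * (V * n)) +
    2 * n * (p ^+ 2 + q ^+ 2) - n by field.
rewrite hn' hc -hu -hv hn.
have -> : 2 * ((u - p) ^+ 2 + (v - q) ^+ 2) = 2 * (u ^+ 2 + v ^+ 2) - 4 * (q * v + p * u)
  + 2 * (p ^+ 2 + q ^+ 2) by ring.
by rewrite hc; ring.
Qed.

End Geometry.

(** * The set N2 *)

Section N2.
Variable R : realType.
Implicit Types z w c : R[i].
Local Arguments ucoord : simpl never.
Local Arguments vcoord : simpl never.

(** The coordinate of [1 / z] attached to the center [i^m (1 - i) / 2]. The fifth entry repeats the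
    first because [k + j - 1] reaches 4. *)
Definition side z (m : nat) : R :=
  let U := ucoord z^-1 in let V := vcoord z^-1 in nth 0 [:: U; V; - U; - V; U] m.

Definition ball_dist w (m : nat) : R :=
  let U := ucoord w^-1 in let V := vcoord w^-1 in
  nth 0 [:: (U - 1) ^+ 2 + V ^+ 2; U ^+ 2 + (V - 1) ^+ 2;
            (U + 1) ^+ 2 + V ^+ 2; U ^+ 2 + (V + 1) ^+ 2; (U - 1) ^+ 2 + V ^+ 2] m.

Lemma ucoord_half z : ucoord (z / 2) = ucoord z / 2.
Proof.
have := ucoordD (z / 2) (z / 2).
by rewrite (_ : z / 2 + z / 2 = z) => [->|]; field.
Qed.
Lemma vcoord_half z : vcoord (z / 2) = vcoord z / 2.
Proof.
have := vcoordD (z / 2) (z / 2).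
by rewrite (_ : z / 2 + z / 2 = z) => [->|]; field.
Qed.

Lemma coord_center m : (m <= 4)%N ->
  ucoord ('i%C ^+ m * (1 - 'i%C) : R[i]) = nth 0 [:: 0; 1; 0; -1; 0] m /\
  vcoord ('i%C ^+ m * (1 - 'i%C) : R[i]) = nth 0 [:: 1; 0; -1; 0; 1] m.
Proof.
have eu : ucoord (1 - 'i%C : R[i]) = 0 by rewrite /ucoord /=; field.
have ev : vcoord (1 - 'i%C : R[i]) = 1 by rewrite /vcoord /=; field.
case: m => [|[|[|[|[|//]]]]] _; rewrite ?exprS expr0 -?mulrA mul1r;
  by rewrite ?(ucoord_mul_i, vcoord_mul_i) eu ev /= ?opprK ?oppr0.
Qed.

Lemma sqnorm_half_center z m : z != 0 -> (m <= 4)%N ->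
  sqnorm (z - 'i%C ^+ m * (1 - 'i%C) / 2) = 1 / 2 + sqnorm z * (1 - 2 * side z m).
Proof.
move=> z0 m4; have [eu ev] := coord_center m4.
have hc : ucoord ('i%C ^+ m * (1 - 'i%C) / 2) ^+ 2 +
    vcoord ('i%C ^+ m * (1 - 'i%C) / 2) ^+ 2 = 1 / 4 :> R.
  rewrite ucoord_half vcoord_half eu ev.
  by case: m m4 {eu ev} => [|[|[|[|[|//]]]]] _ /=; field.
rewrite /side sqnorm_center// ucoord_half vcoord_half eu ev.
by case: m m4 {eu ev hc} => [|[|[|[|[|//]]]]] _ /=; field.
Qed.

Lemma sqnorm_unit_center w m : w != 0 -> (m <= 4)%N ->
  sqnorm (w - 'i%C ^+ m * (1 - 'i%C)) = 1 + 2 * sqnorm w * (ball_dist w m - 1 / 2).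
Proof.
move=> w0 m4; have [eu ev] := coord_center m4.
have hc : ucoord ('i%C ^+ m * (1 - 'i%C)) ^+ 2 +
    vcoord ('i%C ^+ m * (1 - 'i%C)) ^+ 2 = 1 :> R.
  rewrite eu ev.
  by case: m m4 {eu ev} => [|[|[|[|[|//]]]]] _ /=; ring.
rewrite /ball_dist sqnorm_ball// eu ev.
by case: m m4 {eu ev hc} => [|[|[|[|[|//]]]]] _ /=; field.
Qed.

Lemma gt_half_center z m : z != 0 -> (m <= 4)%N ->
  (sqrt2_half R < `|z - 'i%C ^+ m * (1 - 'i%C) / 2|) = (side z m < 1 / 2).
Proof.
move=> z0 m4; rewrite norm_gt_half sqnorm_half_center// ltrDl.
by rewrite pmulr_rgt0 ?sqnorm_gt0//; apply/idP/idP; lra.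
Qed.

Lemma lt_half_center z m : z != 0 -> (m <= 4)%N ->
  (`|z - 'i%C ^+ m * (1 - 'i%C) / 2| < sqrt2_half R) = (1 / 2 < side z m).
Proof.
move=> z0 m4; rewrite norm_lt_half sqnorm_half_center// gtrDl.
by rewrite pmulr_rlt0 ?sqnorm_gt0//; apply/idP/idP; lra.
Qed.

Lemma eq_half_center z m : z != 0 -> (m <= 4)%N ->
  `|z - 'i%C ^+ m * (1 / 2 - 1 / 2 * 'i%C)| = sqrt2_half R <-> side z m = 1 / 2.
Proof.
move=> z0 m4; rewrite norm_eq_half.
rewrite (_ : 'i%C ^+ m * _ = 'i%C ^+ m * (1 - 'i%C) / 2); last by field.
rewrite sqnorm_half_center//; have := sqnorm_gt0 z0; split=> h; last by rewrite h; lra.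
have : sqnorm z * (1 - 2 * side z m) = 0 by lra.
by move=> /eqP; rewrite mulf_eq0 sqnorm_eq0 (negPf z0) /= => /eqP; lra.
Qed.

Lemma ge_unit_center w m : w != 0 -> (m <= 4)%N ->
  (1 <= `|w - 'i%C ^+ m * (1 - 'i%C)|) = (1 / 2 <= ball_dist w m).
Proof.
move=> w0 m4; rewrite norm_ge1 sqnorm_unit_center// lerDl.
by rewrite pmulr_rge0; [apply/idP/idP; lra|have := sqnorm_gt0 w0; lra].
Qed.

(* [X_j] is stated with the centers [i^m (1 + i) / 2 = i^(m+1) (1 - i) / 2]. *)
Lemma mul_i_center m : 'i%C ^+ m * (1 + 'i%C) / 2 = 'i%C ^+ m.+1 * (1 - 'i%C) / 2 :> R[i].
Proof.
rewrite exprSr; congr (_ / _); rewrite -mulrA; congr (_ * _).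
by rewrite mulrBr mulr1 -expr2 sqr_i opprK addrC.
Qed.

Lemma expr_i4 m : 'i%C ^+ m.+4 = 'i%C ^+ m :> R[i].
Proof. by rewrite -addn4 exprD (exprM _ 2 2) sqr_i sqrrN expr1n mulr1. Qed.

Lemma gt_half_center_low z m : z != 0 -> (m <= 5)%N ->
  (sqrt2_half R < `|z - 'i%C ^+ m * (1 + 'i%C) / 2|) = (side z (m.+1 %% 4) < 1 / 2).
Proof.
move=> z0; case: m => [|[|[|[|[|[|//]]]]]] _; rewrite mul_i_center ?expr_i4;
  by rewrite gt_half_center.
Qed.

Lemma center_index (k m j : nat) : (k <= m)%N -> (j <= 4)%N -> (1 <= m)%N ->
  (k + j - 1 <= m + 3)%N.
Proof. lia. Qed.

Lemma high_index (j : nat) : (1 <= j <= 4)%N ->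
  (1 <= j + 4 <= 8)%N /\ (j + 4 <= 4)%N = false.
Proof. lia. Qed.

(** Lines at -1/2 and 1/2 cut the plane of [1 / z] into nine cells: corners give [X_5] to [X_8],
    sides give [X_1] to [X_4], and |z| < 1 excludes the center. The lines at 1/2 give [K_1] and
    [K_2]. *)
Lemma good_N2 z w : tanakaX z -> ~ Qi z -> Qi_conj z w -> good z w -> setN2 (z, w).
Proof.
move=> zX zQ zw [[hb h1 h2 h3 h4] w1 nU nV].
have z0 := not_Qi_neq0 zQ; have w0 := not_Qi_neq0 (Qi_conj_irr zw zQ).
have z1 := tanakaX_sqnorm_lt1 zX zQ.
have [far _ _] := inverse_bounds zX zQ.
have w1' : 1 < `|w| by rewrite norm_gt1.
have inK m : (m <= 1)%N -> side z m = 1 / 2 -> side w m = 1 / 2 -> setN2 (z, w).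
  move=> m1 hz hw; right; exists m.+1 => //=.
  have m4 : (m <= 4)%N by apply: leq_trans m1 _.
  split=> /=; split=> //; rewrite ?subn1 /=; try exact/eq_half_center.
  by apply: ltW; rewrite (@norm_lt_sqnorm R z 1)// expr1n.
have inX j : (1 <= j <= 8)%N -> setX8 j z -> setW8 j w -> setN2 (z, w).
  by move=> hj hX hW; left; left; exists j.
have inlow j : (1 <= j <= 4)%N ->
    (forall k : nat, (k <= 2)%N -> side z ((k + j - 1).+1 %% 4) < 1 / 2) ->
    1 / 2 <= ball_dist w (j - 1) -> setN2 (z, w).
  move=> /andP[j1 j4] hX hW; apply: (inX j); rewrite ?j1 ?(leq_trans j4)//.
    rewrite /setX8 j4; split=> [//|k k2].
    by rewrite gt_half_center_low ?hX//; apply: center_index k2 j4 _.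
  rewrite /setW8 j4; split=> //; rewrite ge_unit_center//.
  by rewrite leq_subLR (leq_trans j4).
have inhigh j : (1 <= j <= 4)%N ->
    (forall k : nat, (k <= 1)%N -> 1 / 2 < side z (k + j - 1)) ->
    (forall k : nat, (k <= 1)%N -> 1 / 2 <= ball_dist w (k + j - 1)) -> setN2 (z, w).
  move=> hj hX hW; have [j8 j5] := high_index hj; have /andP[j1 j4] := hj.
  apply: (inX (j + 4)%N) => //.
    rewrite /setX8 j5 addnK; split=> [//|k k1].
    by rewrite lt_half_center ?hX//; apply: center_index k1 j4 _.
  rewrite /setW8 j5 addnK; split=> [//|k k1].
  by rewrite ge_unit_center ?hW//; apply: center_index k1 j4 _.
have circ (a b : rat) : sqnorm z + ratr a * ucoord z + ratr b * vcoord z + ratr 0 = 0 ->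
    sqnorm w + ratr a * ucoord w + ratr b * vcoord w + ratr 0 = 0.
  exact: Qi_conj_circleR.
have [zu zv] := mul_coordV z0; have [wu wv] := mul_coordV w0.
have wn := sqnorm_gt0 w0.
(* This line is the circle [|z|^2 = 2 vcoord z], with rational coefficients, so [w] lies on it
   too. *)
have [eU|neU] := eqVneq (ucoord z^-1) (1 / 2).
  apply: (inK 0%N) => //; rewrite /side /=; have := circ 0 (- 2).
  rewrite rmorphN /= rmorph0 (ratr_nat R 2) wv zv eU => /(_ ltac:(lra)) e.
  have : sqnorm w * (1 - 2 * ucoord w^-1) = 0 by lra.
  by move=> /eqP; rewrite mulf_eq0 (gt_eqF wn) orFb => /eqP; lra.
have [eV|neV] := eqVneq (vcoord z^-1) (1 / 2).
  apply: (inK 1%N) => //; rewrite /side /=; have := circ (- 2) 0.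
  rewrite rmorphN /= rmorph0 (ratr_nat R 2) wu zu eV => /(_ ltac:(lra)) e.
  have : sqnorm w * (1 - 2 * vcoord w^-1) = 0 by lra.
  by move=> /eqP; rewrite mulf_eq0 (gt_eqF wn) orFb => /eqP; lra.
have split3 (x : R) : x != - (1 / 2) -> x != 1 / 2 ->
    [\/ x < - (1 / 2), - (1 / 2) < x < 1 / 2 | 1 / 2 < x].
  rewrite !neq_lt => /orP[->|->]; first by constructor 1.
  by case/orP=> ->; [constructor 2|constructor 3].
have side3 k : (k <= 2)%N -> [\/ k = 0%N, k = 1%N | k = 2%N].
  by case: k => [|[|[|//]]] _; [constructor 1|constructor 2|constructor 3].
have side2 k : (k <= 1)%N -> k = 0%N \/ k = 1%N.
  by case: k => [|[|//]] _; [left|right].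
have UV := split3 _ nU neU; have := split3 _ nV neV; move: far h1 h2 h3 h4 UV.
clear - inlow inhigh side3 side2.
set U := ucoord z^-1; set V := vcoord z^-1.
have nlt (x : R) : x < - (1 / 2) -> 1 / 2 < - x by rewrite ltrNr.
have ngt (x : R) : - (1 / 2) < x -> - x < 1 / 2 by rewrite ltrNl.
have lt0 (x : R) : x < - (1 / 2) -> x < 1 / 2 by move=> h; lra.
have gt0 (x : R) : 1 / 2 < x -> - x < 1 / 2 by move=> h; lra.
move=> far h1 h2 h3 h4 [hU|/andP[hU hU']|hU] [hV|/andP[hV hV']|hV].
- by apply: (inhigh 3%N isT) => k /side2[->|->]; [exact: (nlt _ hU)|exact: (nlt _ hV)|exact: h2 hU|exact: h4 hV].
- by apply: (inlow 3%N isT) => [k /side3[->|->|->]|]; [exact: ngt _ hV|exact: lt0 _ hU|exact: hV'|exact: (h2 hU)].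
- by apply: (inhigh 2%N isT) => k /side2[->|->]; [exact: hV|exact: (nlt _ hU)|exact: h3 hV|exact: h2 hU].
- by apply: (inlow 4%N isT) => [k /side3[->|->|->]|]; [exact: hU'|exact: lt0 _ hV|exact: ngt _ hU|exact: (h4 hV)].
- by exfalso; clear - far hU hU' hV hV'; nra.
- by apply: (inlow 2%N isT) => [k /side3[->|->|->]|]; [exact: ngt _ hU|exact: gt0 _ hV|exact: hU'|exact: (h3 hV)].
- by apply: (inhigh 4%N isT) => k /side2[->|->]; [exact: (nlt _ hV)|exact: hU|exact: h4 hV|exact: (h1 hU)].
- by apply: (inlow 1%N isT) => [k /side3[->|->|->]|]; [exact: hV'|exact: gt0 _ hU|exact: ngt _ hV|exact: (h1 hU)].
- by apply: (inhigh 1%N isT) => k /side2[->|->]; [exact: hU|exact: hV|exact: (h1 hU)|exact: h3 hV].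
Qed.

End N2.

(** * From N2 to strict pairs *)

Section N2Good.
Variable R : realType.
Implicit Types z w c : R[i].
Local Arguments ucoord : simpl never.
Local Arguments vcoord : simpl never.

Definition weak_off (U V x y : R) :=
  [/\ weakR U V x y, U != - (1 / 2) & V != - (1 / 2)].

Ltac solve_weak_off := move=> *; split; [split; lra|apply/eqP => ?; first [lra|nra]|apply/eqP => ?; first [lra|nra]].

(** One coordinate is confined strictly between -1/2 and 1/2 and the other bounded on one side, so
    at most one neighbour clause is active. For [j = 3, 4] the norm bound keeps the other coordinate
    off -1/2. *)
Lemma low_weak_off z w j : (1 <= j <= 4)%N ->
  1 / 2 < ucoord z^-1 ^+ 2 + vcoord z^-1 ^+ 2 ->
  ucoord w^-1 ^+ 2 + vcoord w^-1 ^+ 2 <= 1 / 2 ->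
  (forall k : nat, (k <= 2)%N -> side z ((k + j - 1).+1 %% 4) < 1 / 2) ->
  1 / 2 <= ball_dist w (j - 1) ->
  weak_off (ucoord z^-1) (vcoord z^-1) (ucoord w^-1) (vcoord w^-1).
Proof.
rewrite /side /ball_dist; move: (ucoord z^-1) (vcoord z^-1) => U V.
move: (ucoord w^-1) (vcoord w^-1) => x y.
move=> hj far hb hs; have := hs 2 isT; have := hs 1 isT; have := hs 0 isT; move: hj far hb.
by case: j {hs} => [|[|[|[|[|j]]]]] //= _; solve_weak_off.
Qed.

Lemma high_weak_off z w j : (1 <= j <= 4)%N ->
  ucoord w^-1 ^+ 2 + vcoord w^-1 ^+ 2 <= 1 / 2 ->
  (forall k : nat, (k <= 1)%N -> 1 / 2 < side z (k + j - 1)) ->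
  (forall k : nat, (k <= 1)%N -> 1 / 2 <= ball_dist w (k + j - 1)) ->
  weak_off (ucoord z^-1) (vcoord z^-1) (ucoord w^-1) (vcoord w^-1).
Proof.
rewrite /side /ball_dist; move: (ucoord z^-1) (vcoord z^-1) => U V.
move: (ucoord w^-1) (vcoord w^-1) => x y.
move=> hj hb hs hs'; have := hs' 1 isT; have := hs' 0 isT.
have := hs 1 isT; have := hs 0 isT; move: hj hb.
by case: j {hs hs'} => [|[|[|[|[|j]]]]] //= _; solve_weak_off.
Qed.

(** For [m = 0], [U = x = 1/2] and the norm bounds give |V| > 1/2 and |y| <= 1/2, so [(x, y)] is far
    enough from [(0, 1)] and [(0, -1)]. *)
Lemma circle_weak_off z w m : (m <= 1)%N ->
  1 / 2 < ucoord z^-1 ^+ 2 + vcoord z^-1 ^+ 2 ->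
  ucoord w^-1 ^+ 2 + vcoord w^-1 ^+ 2 <= 1 / 2 ->
  side z m = 1 / 2 -> side w m = 1 / 2 ->
  weak_off (ucoord z^-1) (vcoord z^-1) (ucoord w^-1) (vcoord w^-1).
Proof.
rewrite /side; move: (ucoord z^-1) (vcoord z^-1) => U V.
move: (ucoord w^-1) (vcoord w^-1) => x y.
case: m => [|[|//]] _ /= far hb e e'; rewrite {}e {}e' in far hb *.
- have y1 : y <= 1 / 2 by nra.
  have y2 : - (1 / 2) <= y by nra.
  by split; [split; first [lra|nra]|apply/eqP; lra|apply/eqP => e; rewrite e in far; lra].
- have x1 : x <= 1 / 2 by nra.
  have x2 : - (1 / 2) <= x by nra.
  by split; [split; first [lra|nra]|apply/eqP => e; rewrite e in far; lra|apply/eqP; lra].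
Qed.

(** [n/2 - x] and [n/2 + x] are the squares of [x - 1/2] and [x + 1/2], nonzero because [n < 1];
    this confines [B = x / n]. *)
Lemma edge_real (n x A B : R) : n = 2 * (x ^+ 2 + 1 / 4) -> n < 1 ->
  - (1 / 2) = A * n -> x = B * n -> A < - (1 / 2) /\ - (1 / 2) < B < 1 / 2.
Proof.
move=> en n1 eA eB; have n0 : 1 / 2 <= n by rewrite en; have := sqr_ge0 x; lra.
split; first by rewrite ltNge; apply/negP => h; nra.
have x1 : (x - 1 / 2) ^+ 2 > 0.
  rewrite lt0r sqr_ge0 andbT sqrf_eq0 subr_eq0; apply/eqP => h.
  by move: n1; rewrite en h; lra.
have x2 : (x + 1 / 2) ^+ 2 > 0.
  rewrite lt0r sqr_ge0 andbT sqrf_eq0 addr_eq0; apply/eqP => h.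
  by move: n1; rewrite en h; lra.
apply/andP; split; rewrite ltNge; apply/negP => h.
- have : B * n <= - (1 / 2) * n by rewrite ler_wpM2r//; lra.
  by rewrite -eB; lra.
- have : 1 / 2 * n <= B * n by rewrite ler_wpM2r//; lra.
  by rewrite -eB; lra.
Qed.

Lemma coord_line (s t : R) : s + t = 1 ->
  ucoord (s%:C - 'i%C * t%:C) = (s - t) / 2 /\ vcoord (s%:C - 'i%C * t%:C) = 1 / 2.
Proof. by move=> e; rewrite /ucoord /vcoord /=; split; lra. Qed.

Lemma N2_good z w : tanakaX z -> ~ Qi z -> Qi_conj z w -> setN2 (z, w) -> good z w.
Proof.
move=> zX zQ zw hN.
have wQ := Qi_conj_irr zw zQ.
have z0 := not_Qi_neq0 zQ; have w0 := not_Qi_neq0 wQ.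
have [far _ _] := inverse_bounds zX zQ.
suff [w1 hoff] : 1 < sqnorm w /\
    (ucoord w^-1 ^+ 2 + vcoord w^-1 ^+ 2 <= 1 / 2 ->
     weak_off (ucoord z^-1) (vcoord z^-1) (ucoord w^-1) (vcoord w^-1)).
  by have [hw hU hV] := hoff (ltW (inv_sqnorm_lt w1)); split.
have wY (s t : R) : sqnorm w = s ^+ 2 + t ^+ 2 -> s + t = 1 -> s <= 0 -> 1 <= t ->
    1 < sqnorm w.
  move=> e st s0 t1; rewrite lt_neqAle eq_sym (sqnorm_conj_neq1 zX zQ zw) e /=.
  by have := sqr_ge0 s; nra.
case: hN => [[[j /= hj [hX hW]]|[j /= hj [hY hY']]]|[j /= hj [hK hK']]].
- have [jle|jgt] := leqP j 4.
    move: hX hW; rewrite /setX8 /setW8 jle /= => -[_ hX] [w1 hW].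
    have /andP[j1 _] := hj.
    split; [by rewrite -norm_gt1|move=> hb; apply: (@low_weak_off z w j)] => //.
    + by rewrite j1.
    + by move=> k k2; rewrite -gt_half_center_low ?hX//; apply: center_index k2 jle _.
    + rewrite -ge_unit_center//.
      by rewrite leq_subLR (leq_trans jle).
  move: hX hW; rewrite /setX8 /setW8 leqNgt jgt /= => -[_ hX] [w1 hW].
  have [j1 j4] : (1 <= j - 4)%N /\ (j - 4 <= 4)%N by move: hj jgt; clear; lia.
  split; [by rewrite -norm_gt1|move=> hb; apply: (@high_weak_off z w (j - 4))] => //.
  + by rewrite j1.
  + by move=> k k1; rewrite -lt_half_center ?hX//; apply: center_index k1 j4 _.
  + by move=> k k1; rewrite -ge_unit_center ?hW//; apply: center_index k1 j4 _.
- have z1 := tanakaX_sqnorm_lt1 zX zQ.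
  have [zu zv] := mul_coordV z0.
  move: hY hY' => [s [t [ez st _]]] [s' [t' [ew st' s'0 t'1]]].
  have [lu lv] := coord_line st; have [lu' lv'] := coord_line st'.
  have hn := sqnormE z; have hm := sqnormE w.
  have sq : 1 <= (s' - t') ^+ 2 by nra.
  (* The power of i puts [z] on the edge [vcoord z = -1/2] or [ucoord z = -1/2]; [edge_real] then
     gives the side inequalities for the same [j]. *)
  have [ej|ej] : j = 3%N \/ j = 4%N by move: hj; clear; lia.
  + have i2 x : 'i%C ^+ (3 - 1) * x = 'i%C * ('i%C * x) :> R[i].
      by rewrite (_ : (3 - 1)%N = 2%N)// expr2 mulrA.
    rewrite ej !i2 in ez ew.
    have uz : ucoord z = - ((s - t) / 2) by rewrite ez ucoord_mul_i vcoord_mul_i lu.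
    have vz : vcoord z = - (1 / 2) by rewrite ez vcoord_mul_i ucoord_mul_i lv.
    have uw : ucoord w = - ((s' - t') / 2) by rewrite ew ucoord_mul_i vcoord_mul_i lu'.
    have vw : vcoord w = - (1 / 2) by rewrite ew vcoord_mul_i ucoord_mul_i lv'.
    have w1 : 1 < sqnorm w by apply: (@wY s' t') => //; rewrite hm uw vw; nra.
    split=> // hb.
    have [||hU /andP[hV hV']] := @edge_real (sqnorm z) (ucoord z)
        (ucoord z^-1) (vcoord z^-1) _ z1 _ zu.
    - by rewrite hn vz; field.
    - by rewrite -zv vz.
    apply: (@low_weak_off z w 3) => //.
      move=> k; rewrite /side; move: hU hV hV'; clear.
      by case: k => [|[|[|//]]] /= *; lra.
    rewrite -ge_unit_center// norm_ge1 sqnormE ucoordB vcoordB.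
    have [-> ->] := @coord_center R 2 isT.
    by rewrite uw vw /=; move: sq; clear; lra.
  + have i3 x : 'i%C ^+ (4 - 1) * x = 'i%C * ('i%C * ('i%C * x)) :> R[i].
      by rewrite (_ : (4 - 1)%N = 3%N)// exprS expr2 !mulrA.
    rewrite ej !i3 in ez ew.
    have uz : ucoord z = - (1 / 2) by rewrite ez !(ucoord_mul_i, vcoord_mul_i) lv.
    have vz : vcoord z = (s - t) / 2 by rewrite ez !(ucoord_mul_i, vcoord_mul_i) opprK lu.
    have uw : ucoord w = - (1 / 2) by rewrite ew !(ucoord_mul_i, vcoord_mul_i) lv'.
    have vw : vcoord w = (s' - t') / 2 by rewrite ew !(ucoord_mul_i, vcoord_mul_i) opprK lu'.
    have w1 : 1 < sqnorm w by apply: (@wY s' t') => //; rewrite hm uw vw; nra.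
    split=> // hb.
    have [||hV /andP[hU hU']] := @edge_real (sqnorm z) (vcoord z)
        (vcoord z^-1) (ucoord z^-1) _ z1 _ zv.
    - by rewrite hn uz; field.
    - by rewrite -zu uz.
    apply: (@low_weak_off z w 4) => //.
      move=> k; rewrite /side; move: hV hU hU'; clear.
      by case: k => [|[|[|//]]] /= *; lra.
    rewrite -ge_unit_center// norm_ge1 sqnormE ucoordB vcoordB.
    have [-> ->] := @coord_center R 3 isT.
    by rewrite uw vw /=; move: sq; clear; lra.
- have /andP[j1 j2] := hj.
  have j3 : (j - 1 <= 1)%N by rewrite leq_subLR.
  have j4 : (j - 1 <= 4)%N by apply: leq_trans j3 _.
  move: hK hK' => [hK _] [hK' w1]; split; first by rewrite -norm_gt1.
  move=> hb; apply: (@circle_weak_off z w (j - 1)) => //.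
  + exact/(eq_half_center z0 j4).
  + exact/(eq_half_center w0 j4).
Qed.

End N2Good.

Theorem theorem6p3 (R : realType) (alpha : R[i])
    (alpha_X : tanakaX alpha) (alpha_irr : ~ Qi alpha) :
  purely_periodic alpha <->
  quadratic_irrational alpha /\
  exists2 alpha' : R[i], Qi_conjugate alpha alpha' & setN2 (alpha, alpha').
Proof.
rewrite purely_periodicE//; split=> [[l l0 el]|[_ [w zw hN]]].
  have [w zw] := periodic_conj alpha_X alpha_irr l0 el.
  have zw' : Qi_conjugate alpha w by apply/Qi_conjugateE.
  split; first exact: Qi_conjugate_quadratic zw'.
  exists w => //; apply: good_N2 => //.
  exact: periodic_good zw l0 el.
move: zw => /(Qi_conjugateE _ alpha_irr) zw.
have hg := N2_good alpha_X alpha_irr zw hN.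
have [l l0 e] : exists2 l, (0 < l)%N & iter l (@conj_step R) (alpha, w) = (alpha, w).
  by apply: reduced_periodic; split.
(* The first component of the orbit of pairs is the orbit of [alpha]. *)
by exists l => //; rewrite -(conj_step1 l (alpha, w)) e.
Qed.
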